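(* Let $d\ge2$ and $q_1,\dots,q_d\ge2$ be integers and let $P$ be the simple random walk operator on $\ell^2(\mathrm{DL})$, $\mathrm{DL}=\mathrm{DL}(q_1,\dots,q_d)$. The spectrum of $P$ is pure point. It is the closure of the set of eigenvalues $$\mathrm{spec}_p(P)=\{\lambda_{\mathbf m,N}: N\ge2,\ \mathbf m\in B_N^o\}=\bigcup_{N\ge2}\mathrm{spec}(Q_N).$$ Each eigenvalue has infinite multiplicity. An associated orthonormal basis of $\ell^2(\mathrm{DL})$ consisting of finitely supported eigenfunctions of $P$ is given by $$\mathfrak B=\bigl\{g_{\mathbf m}[\mathsf S,\varphi^1_{l_1},\dots,\varphi^d_{l_d}]:\ \mathsf S\text{ polyhedron in }\mathrm{DL}\text{ with }N(\mathsf S)\ge2,\ \mathbf m\in B^o_{N(\mathsf S)},\ l_j\in\{1,\dots,q_j-1\}\bigr\}.$$ All objects are defined in the context.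
   Context: $\mathbb T_q$ is the homogeneous tree with all degrees $q+1$, with graph metric $d(\cdot,\cdot)$, a fixed origin $o$ and a fixed end $\omega$ (class of geodesic rays, two rays being equivalent if their symmetric difference is finite). The predecessor $x^-$ of $x$ is its neighbour on the ray from $x$ to $\omega$; the other $q$ neighbours are its successors; $x\preccurlyeq y$ means that $x$ lies on the ray from $y$ to $\omega$; $x\curlywedge y$ is the maximal common ancestor; $\mathfrak h(x)=d(x,x\curlywedge o)-d(o,x\curlywedge o)$. The edges of $\mathbb T_q$ are labelled by $\mathfrak Z_q=\{0,\dots,q-1\}$ such that the edges from each vertex to its successors carry distinct labels and only finitely many labels on the ray from any vertex to $\omega$ are non-zero. Let $T_j=\mathbb T_{q_j}$ and $H_k^j=\{x\in T_j:\mathfrak h(x)=k\}$. $\mathrm{DL}(q_1,\dots,q_d)$ has vertex set $\{x_1\cdots x_d\in\prod_jT_j:\sum_j\mathfrak h(x_j)=0\}$; $x_1\cdots x_d\sim y_1\cdots y_d$ iff there are $i\ne j$ with $x_i\sim y_i$, $x_j\sim y_j$, and $x_k=y_k$ for $k\ne i,j$. It is regular of degree $D=(d-1)\sum_iq_i$. The simple random walk operator is $Pf(x)=\frac1D\sum_{y\sim x}f(y)$ on $\ell^2(\mathrm{DL})$ (complex square-summable functions). Let $\mathbb A_{d-1}=\{\mathbf k\in\mathbb Z^d:k_1+\dots+k_d=0\}$, with $\mathbf e_i$ the unit vectors of $\mathbb Z^d$. For $N\ge 2$: $B_N=\{\mathbf k\in\mathbb A_{d-1}:k_1,\dots,k_{d-1}\ge0,\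 k_d\ge-N\}$, $B_N^o=\{\mathbf k\in\mathbb A_{d-1}:k_1,\dots,k_{d-1}>0,\ k_d>-N\}$, $\partial B_N=B_N\setminus B_N^o$. $\mathfrak V_0(B_N)$ is the space of functions $B_N\to\mathbb C$ vanishing on $\partial B_N$, and $Q_N:\mathfrak V_0(B_N)\to\mathfrak V_0(B_N)$ is the symmetric operator $$Q_Nf(\mathbf k)=\frac1D\sum_{i=1}^d\sum_{j\ne i}\sqrt{q_iq_j}\,f(\mathbf k+\mathbf e_i-\mathbf e_j)\ \ (\mathbf k\in B_N^o),\qquad Q_Nf(\mathbf k)=0\ \ (\mathbf k\in\partial B_N).$$ $\{\psi_{\mathbf m,N}:\mathbf m\in B_N^o\}$ is an orthonormal basis of $\mathfrak V_0(B_N)$ consisting of eigenfunctions of $Q_N$, with eigenvalues $\lambda_{\mathbf m,N}$ (parametrized by $\mathbf m\in B_N^o$). For vertices $a_j\in T_j$ with $N=-\sum_j\mathfrak h(a_j)\ge2$, the polyhedron $\mathsf S=\mathsf S(a_1,\dots,a_d)$ is the induced subgraph of $\mathrm{DL}$ on $\{x_1\cdots x_d\in\mathrm{DL}:a_j\preccurlyeq x_j\ \forall j\}$; its height is $N(\mathsf S)=N$ and $\mathbf h(\mathsf S)=(\mathfrak h(a_1),\dots,\mathfrak h(a_d))$. Let $v_{j,l}$ be the successor of $a_j$ such that the edge from $a_j$ to $v_{j,l}$ has label $l$. For $\varphi^j:\mathfrak Z_{q_j}\to\mathbb C$ with $\sum_l\varphi^j(l)=0$ and $\sum_l\varphi^j(l)^2=1$,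 put $$f_k^j(x_j)=\varphi^j(l)\,q_j^{(\mathfrak h(a_j)-k+1)/2}\ \text{ if }k>\mathfrak h(a_j)\text{ and }v_{j,l}\preccurlyeq x_j\in H_k^j,\qquad f_k^j(x_j)=0\text{ otherwise},$$ and $f_{\mathbf k,\mathsf S}(x)=\prod_{j=1}^df^j_{k_j}(x_j)$ for $\mathbf k\in\mathbb A_{d-1}$, $x=x_1\cdots x_d\in\mathrm{DL}$. With $\mathbf h=\mathbf h(\mathsf S)$, $N=N(\mathsf S)$, set $$g_{\mathbf m}[\mathsf S,\varphi^1,\dots,\varphi^d]=\sum_{\mathbf k\in B_N^o}\psi_{\mathbf m,N}(\mathbf k)\,f_{\mathbf k+\mathbf h+N\mathbf e_d,\mathsf S},\qquad\mathbf m\in B_N^o.$$ Finally, for $l\in\{1,\dots,q_j-1\}$, $\varphi^j_l:\mathfrak Z_{q_j}\to\mathbb R$ is given by $\varphi^j_l(s)=0$ for $0\le s\le l-2$, $\varphi^j_l(l-1)=(q_j-l)/\sqrt{(q_j-l)(q_j+1-l)}$, and $\varphi^j_l(s)=-1/\sqrt{(q_j-l)(q_j+1-l)}$ for $l\le s\le q_j-1$. *)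

(* Defs.v *)
Set Warnings "-notation-overridden,-notation-incompatible-prefix,-ambiguous-paths".
From HB Require Import structures.
From mathcomp Require Import all_boot all_order all_algebra complex.
From mathcomp Require Import all_classical all_reals all_analysis.

Set Implicit Arguments.
Unset Strict Implicit.
Unset Printing Implicit Defensive.

Import Order.TTheory GRing.Theory Num.Theory.
Import numFieldNormedType.Exports.

Local Open Scope classical_set_scope.
Local Open Scope card_scope.
Local Open Scope ring_scope.
Local Open Scope complex_scope.

Section Graphs.
Variables (V : choiceType) (E : rel V).

Definition walk (x y : V) (n : nat) : Prop :=
  exists p : seq V, [/\ path E x p, last x p = y & size p = n].

(* Meaningful for connected graphs; the default 0 is irrelevant then. *)
Definition gdist (x y : V) : nat :=
  xget 0%N [set n | walk x y n /\ forall m, walk x y m -> (n <= m)%N].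

(* In a simple graph a closed duplicate-free walk x :: p is a cycle as soon as
   it has at least three vertices; [ucycle] also accepts the empty walk and
   the back-and-forth walk along one edge. *)
Definition is_tree : Prop :=
  [/\ symmetric E, irreflexive E, (forall x y, exists n, walk x y n)
    & forall c : seq V, ucycle E c -> (size c <= 2)%N].

Definition regular (k : nat) : Prop := forall x, [set y | E x y] #= `I_k.

Definition geodesic_ray (r : nat -> V) : Prop :=
  forall i n, gdist (r i) (r (i + n)%N) = n.

Definition ray_equiv (r s : nat -> V) : Prop :=
  finite_set (range r `+` range s).

Definition is_end (w : set (nat -> V)) : Prop :=
  exists2 r, geodesic_ray r & w = [set s | geodesic_ray s /\ ray_equiv r s].

Section Ancestors.
Variable w : set (nat -> V).

Definition ray_to (x : V) (r : nat -> V) : Prop := w r /\ r 0%N = x.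

Definition predec (x : V) : V := xget x [set y | exists2 r, ray_to x r & r 1%N = y].

Definition succ_of (x y : V) : Prop := E x y /\ y <> predec x.

Definition anc (x y : V) : Prop := exists2 r, ray_to y r & range r x.

Definition confluent (x y : V) : V :=
  xget x [set c | [/\ anc c x, anc c y &
                      forall c', anc c' x -> anc c' y -> anc c' c]].

Definition busemann (o x : V) : int :=
  (gdist x (confluent x o))%:Z - (gdist o (confluent x o))%:Z.

End Ancestors.
End Graphs.

(* The homogeneous tree of degree q+1 with an origin, an end and a labelling.
   [lab x y] is only used when y is a successor of x, and is then the label of
   the edge joining x and y. *)
Record tree (q : nat) := Tree {
  vert :> choiceType;
  edge : rel vert;
  origin : vert;
  omega : set (nat -> vert);
  lab : vert -> vert -> 'I_q;
  tree_tree : is_tree edge;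
  tree_regular : regular edge q.+1;
  tree_end : is_end edge omega;
  tree_lab_inj : forall x y z, succ_of edge omega x y -> succ_of edge omega x z ->
    lab x y = lab x z -> y = z;
  tree_lab_finite : forall x r, ray_to omega x r ->
    finite_set [set n | lab (r n.+1) (r n) != 0%N :> nat]
}.

Definition is_succ (q : nat) (T : tree q) (x y : T) : Prop :=
  succ_of (@edge q T) (@omega q T) x y.

Definition ancestor (q : nat) (T : tree q) (x y : T) : Prop :=
  anc (@omega q T) x y.

Definition height (q : nat) (T : tree q) (x : T) : int :=
  busemann (@edge q T) (@omega q T) (origin T) x.

Section HilbertSpace.
Variables (R : realType) (X : choiceType).
Local Notation C := R[i].
Implicit Types (f g : X -> C) (A B : (X -> C) -> X -> C) (z : C).

Definition sqr_mod (z : C) : R := (complex.Re z) ^+ 2 + (complex.Im z) ^+ 2.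

Definition l2 f : Prop := (\esum_(x in [set: X]) (sqr_mod (f x))%:E < +oo)%E.

Definition l2norm f : R :=
  Num.sqrt (fine (\esum_(x in [set: X]) (sqr_mod (f x))%:E)).

(* Sum of an absolutely summable real family. *)
Definition rsum (u : X -> R) : R :=
  fine (\esum_(x in [set: X]) (Num.max (u x) 0)%:E) -
  fine (\esum_(x in [set: X]) (Num.max (- u x) 0)%:E).

Definition l2inner f g : C :=
  rsum (fun x => complex.Re (f x * (g x)^*)) +i*
  rsum (fun x => complex.Im (f x * (g x)^*)).

(* Operators on l2 are given by their values on all functions X -> C; only the
   restriction to l2 matters. *)
Definition bounded_operator A : Prop :=
  [/\ forall f, l2 f -> l2 (A f),
      forall c f g, l2 f -> l2 g ->
        A (fun x => c * f x + g x) = (fun x => c * A f x + A g x)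
    & exists M : R, forall f, l2 f -> l2norm (A f) <= M * l2norm f].

Definition resolvent_set A : set C :=
  [set z | exists2 B, bounded_operator B &
    forall f, l2 f ->
      B (fun x => A f x - z * f x) = f /\
      (fun x => A (B f) x - z * B f x) = f].

Definition spectrum A : set C := ~` resolvent_set A.

Definition eigenfunction A z f : Prop :=
  [/\ l2 f, f <> (fun=> 0) & A f = (fun x => z * f x)].

Definition point_spectrum A : set C := [set z | exists f, eigenfunction A z f].

Definition infinite_multiplicity A z : Prop :=
  forall n : nat, exists g : 'I_n -> X -> C,
    (forall i, eigenfunction A z (g i)) /\
    forall c : 'I_n -> C, (forall x, \sum_i c i * g i x = 0) ->
      forall i, c i = 0.

Definition total_in_l2 (S : set (X -> C)) : Prop :=
  forall f, l2 f -> forall e : R, 0 < e ->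
    exists (n : nat) (c : 'I_n -> C) (g : 'I_n -> X -> C),
      (forall i, S (g i)) /\ l2norm (fun x => f x - \sum_i c i * g i x) < e.

(* l2 is the closed linear span of the eigenfunctions. *)
Definition pure_point A : Prop :=
  total_in_l2 [set f | exists z, eigenfunction A z f].

Definition orthonormal_basis (S : set (X -> C)) : Prop :=
  [/\ S `<=` l2,
      forall f g, S f -> S g -> l2inner f g = (`[< f = g >])%:R
    & total_in_l2 S].

End HilbertSpace.

Section HorocyclicProduct.
Variables (d : nat) (q : 'I_d -> nat) (T : forall j, tree (q j)).

Definition DL : choiceType :=
  {x : {dffun forall j : 'I_d, T j} | \sum_j height (x j) == 0}.

Definition dlcoord (x : DL) (j : 'I_d) : T j := sval x j.

Definition dl_adj (x y : DL) : Prop :=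
  exists i j : 'I_d,
    [/\ i != j,
        edge (dlcoord x i) (dlcoord y i),
        edge (dlcoord x j) (dlcoord y j)
      & forall k, k != i -> k != j -> dlcoord x k = dlcoord y k].

Definition dl_deg : nat := (d.-1 * \sum_i q i)%N.

Definition srw (R : realType) (f : DL -> R[i]) : DL -> R[i] :=
  fun x => dl_deg%:R^-1 * \sum_(y \in [set y | dl_adj x y]) f y.

End HorocyclicProduct.

(* Points of Z^d are row vectors; the coordinate k_d is the one whose index j
   satisfies j.+1 = d. *)
Section Simplex.
Variables (d : nat) (q : 'I_d -> nat).

Definition lastc (j : 'I_d) : bool := j.+1 == d.

Definition evec (i : 'I_d) : 'rV[int]_d := delta_mx 0 i.

Definition evec_last : 'rV[int]_d := \row_j (lastc j)%:R.

Definition inA (k : 'rV[int]_d) : bool := \sum_j k 0 j == 0.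

Definition inB (N : nat) (k : 'rV[int]_d) : bool :=
  inA k && [forall j, if lastc j then - N%:Z <= k 0 j else 0 <= k 0 j].

Definition inBo (N : nat) (k : 'rV[int]_d) : bool :=
  inA k && [forall j, if lastc j then - N%:Z < k 0 j else 0 < k 0 j].

Definition inbd (N : nat) (k : 'rV[int]_d) : bool := inB N k && ~~ inBo N k.

Variable R : realType.
Local Notation C := R[i].

(* Functions on B_N are represented by functions on Z^d that vanish off B_N. *)
Definition V0 (N : nat) : set ('rV[int]_d -> C) :=
  [set u | (forall k, ~~ inB N k -> u k = 0) /\ (forall k, inbd N k -> u k = 0)].

Definition Qop (N : nat) (u : 'rV[int]_d -> C) : 'rV[int]_d -> C :=
  fun k => if inBo N k then
    (dl_deg q)%:R^-1 *
      \sum_i \sum_(j | j != i)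
         (Num.sqrt ((q i * q j)%:R : R))%:C * u (k + evec i - evec j)
  else 0.

Definition specQ (N : nat) : set C :=
  [set z | exists u, [/\ V0 N u, u <> (fun=> 0) & Qop N u = (fun k => z * u k)]].

Definition V0inner (N : nat) (u v : 'rV[int]_d -> C) : C :=
  \sum_(k \in [set k | inB N k]) u k * (v k)^*.

(* [psi m], for m in the interior of B_N, is an orthonormal basis of V0 N
   consisting of eigenfunctions of Q_N, with eigenvalues [lam m]. *)
Definition Q_eigenbasis (N : nat)
    (psi : 'rV[int]_d -> 'rV[int]_d -> C) (lam : 'rV[int]_d -> C) : Prop :=
  [/\ forall m, inBo N m -> V0 N (psi m),
      forall m m', inBo N m -> inBo N m' ->
        V0inner N (psi m) (psi m') = (m == m')%:R,
      forall u, V0 N u -> exists c : 'rV[int]_d -> C,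
        u = (fun k => \sum_(m \in [set m | inBo N m]) c m * psi m k)
    & forall m, inBo N m -> Qop N (psi m) = (fun k => lam m * psi m k)].

End Simplex.

Section Basis.
Variables (R : realType) (d : nat) (q : 'I_d -> nat).
Variable T : forall j, tree (q j).
Local Notation C := R[i].

(* The label l of the branch below a containing x, for a strict descendant x
   of a, is the one such that v_l is an ancestor of x. *)
Definition ftree (j : 'I_d) (a : T j) (phi : 'I_(q j) -> C) (k : int)
    (x : T j) : C :=
  if [pick l : 'I_(q j) | `[< [/\ height a < k, height x = k &
        exists v, [/\ is_succ a v, lab a v = l & ancestor v x]] >]] is Some l
  then phi l * (((q j)%:R : R) `^ ((height a - k + 1)%:~R / 2))%:C
  else 0.

Definition fprodk (a : forall j, T j) (phi : forall j, 'I_(q j) -> C)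
    (k : 'rV[int]_d) (x : DL T) : C :=
  \prod_j ftree (a j) (phi j) (k 0 j) (dlcoord x j).

(* A polyhedron S(a_1,...,a_d) enters only through its apices a_j, which also
   determine its height N(S) and the vector h(S). *)
Definition polyheight (a : forall j, T j) : int := - \sum_j height (a j).

Definition hvec (a : forall j, T j) : 'rV[int]_d := \row_j height (a j).

(* [u] stands for the function psi_{m,N} on B_N. *)
Definition gfun (a : forall j, T j) (N : nat) (u : 'rV[int]_d -> C)
    (phi : forall j, 'I_(q j) -> C) (x : DL T) : C :=
  \sum_(k \in [set k | inBo N k])
     u k * fprodk a phi (k + hvec a + evec_last d *+ N) x.

(* 'l - 2' in the case s <= l - 2 is not truncated: s <= l - 2 iff s < l.-1. *)
Definition phil (n l : nat) (s : 'I_n) : R :=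
  if (s < l.-1)%N then 0
  else if (s == l.-1 :> nat) then
    (n - l)%N%:R / Num.sqrt ((n - l) * (n + 1 - l))%N%:R
  else - (1 / Num.sqrt ((n - l) * (n + 1 - l))%N%:R).

Definition basis_fun (a : forall j, T j) (N : nat) (u : 'rV[int]_d -> C)
    (l : 'I_d -> nat) : DL T -> C :=
  gfun a N u (fun j s => (phil (l j) s)%:C).

(* The parameters of the basis: the apices of a polyhedron of height N >= 2, an
   interior point of B_N and the indices l_j. *)
Definition basis_index (a : forall j, T j) (N : nat) (m : 'rV[int]_d)
    (l : 'I_d -> nat) : Prop :=
  [/\ N%:Z = polyheight a, (2 <= N)%N, inBo N m
    & forall j, (1 <= l j <= q j - 1)%N].

Definition basisB (psi : nat -> 'rV[int]_d -> 'rV[int]_d -> C) :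
    set (DL T -> C) :=
  [set g | exists a N m l, basis_index a N m l /\ g = basis_fun a N (psi N m) l].

End Basis.

Arguments srw {d q} T R.
Arguments specQ {d} q R.
Arguments basisB {R d q} T psi.

(* Main.v *)
Require Import Defs.
Set Warnings "-notation-overridden,-notation-incompatible-prefix,-ambiguous-paths".
From mathcomp Require Import all_boot all_order all_algebra complex zify ring lra.
From mathcomp Require Import all_classical all_reals all_analysis.
Import Order.TTheory GRing.Theory Num.Theory numFieldNormedType.Exports.
Local Open Scope classical_set_scope.
Local Open Scope ring_scope.
Local Open Scope complex_scope.

Set Implicit Arguments.
Unset Strict Implicit.
Unset Printing Implicit Defensive.

(** Each tree T_j is described by its parent map x -> x^-: rays to the end omega
    are the orbits of the parent map, the height drops by one along it
    (height_par), and the q_j successors of a vertex are indexed by their labels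
    (childP). On a horocycle of T_j, the functions attached to the vertices a
    above it and to the functions phil, which have sum zero and norm one, are
    orthonormal (orthogonal_treefun, sum_treefun_sqr). They are total: the
    normalised indicators of larger and larger sets around a point x differ by
    multiples of such functions and tend to zero in norm, so that the point mass
    at x is a limit of their combinations (point_decomposition). Products over j
    are therefore total on each product of horocycles (point_span), and DL is the
    disjoint union of those products whose heights add up to zero.

    Fix a polyhedron S and functions phi^j, and attach to a function u on B_N
    the function x -> u(k(x)) prod_j f^j(x_j) on DL, where k(x) is the vector of
    the heights of x above the apices of S. A step of the random walk goes up in
    one tree T_i and down in another tree T_j. Summation over the successors in
    T_i yields a factor sqrt q_i, also at the apex, where both sides vanish
    because phi^i has sum zero; the step down in T_j yields a factor sqrt q_j
    as long as x_j^- is strictly below the apex, and otherwise u vanishes. So P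
    acts on these functions as Q_N acts on u (srw_gfun), and the correspondence
    is isometric up to the norms of the phi^j (inner_gfun_same). Hence
    eigenfunctions of Q_N give finitely supported eigenfunctions of P; for
    different polyhedra they are orthogonal (inner_gfun_neq), which gives infinite
    multiplicity, and since the psi_(m,N) span all functions on the interior of
    B_N, they are total by the previous paragraph.

    It remains to apply a general fact to P, which is symmetric and of finite
    range: if a total orthonormal family consists of finitely supported
    eigenfunctions, then their eigenvalues are the only ones, because an
    eigenfunction for another value would be orthogonal to the family
    (point_spectrum_family), and the spectrum is the closure of the set of
    eigenvalues (spectrum_closure). Indeed, if z has positive distance from the
    eigenvalues, then P - z is bounded below on finite combinations of the
    family and maps them onto such combinations; completeness of l2 turns this
    into a bounded inverse. *)

(** * Distances and rays in a tree *)

Section TreeDistance.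
Variables (V : choiceType) (E : rel V).
Hypothesis tE : is_tree E.

Let Esym : symmetric E. Proof. by case: tE. Qed.
Let Eirr x : E x x = false. Proof. by case: tE => _ ->. Qed.

Lemma gdistP x y :
  walk E x y (gdist E x y) /\ forall m, walk E x y m -> (gdist E x y <= m)%N.
Proof.
rewrite /gdist; case: xgetP => [n _ //|nex]; exfalso.
have [_ _ /(_ x y) ex _] := tE.
have exb : exists n, `[< walk E x y n >] by case: ex => n ?; exists n; apply/asboolP.
case: (ex_minnP exb) => n /asboolP wn minn; apply: (nex n); split=> // m wm.
by apply: minn; apply/asboolP.
Qed.

Lemma walk_trans x y z m n : walk E x y m -> walk E y z n -> walk E x z (m + n).
Proof.
move=> [p [pp lp <-]] [s [ps ls <-]]; exists (p ++ s).
by rewrite cat_path last_cat pp lp ps ls size_cat.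
Qed.

Lemma walk_sym x y n : walk E x y n -> walk E y x n.
Proof.
move=> [p [pp <- <-]]; exists (rev (belast x p)).
rewrite size_rev size_belast rev_path; split=> //.
  by rewrite (eq_path (e' := E)) // => a b /=; rewrite Esym.
by case: p {pp} => //= a p; rewrite rev_cons last_rcons.
Qed.

Lemma walk_edge x y : E x y -> walk E x y 1.
Proof. by move=> xy; exists [:: y]; rewrite /= xy. Qed.

Lemma gdist_le x y n : walk E x y n -> (gdist E x y <= n)%N.
Proof. by case: (gdistP x y) => _; apply. Qed.

Lemma gdist_walk x y : walk E x y (gdist E x y).
Proof. by case: (gdistP x y). Qed.

Lemma gdistC x y : gdist E x y = gdist E y x.
Proof.
by apply/eqP; rewrite eqn_leq !gdist_le //; apply/walk_sym/gdist_walk.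
Qed.

Lemma gdist_triangle y x z : (gdist E x z <= gdist E x y + gdist E y z)%N.
Proof. by apply/gdist_le/walk_trans; apply: gdist_walk. Qed.

Lemma gdistxx x : gdist E x x = 0%N.
Proof. by apply/eqP; rewrite -leqn0; apply: gdist_le; exists [::]. Qed.

Lemma gdist_eq0 x y : gdist E x y = 0%N -> x = y.
Proof. by move=> d0; have := gdist_walk x y; rewrite d0 => -[[|? ?]] [] //= _ <-. Qed.

Lemma gdist_edge_le x y z : E x y -> (gdist E x z <= (gdist E y z).+1)%N.
Proof.
by move=> /walk_edge/gdist_le xy; have := gdist_triangle y x z; lia.
Qed.

Lemma gdist_step x z n : gdist E x z = n.+1 -> exists2 y, E x y & gdist E y z = n.
Proof.
move=> dx; have := gdist_walk x z; rewrite dx => -[[|y p]] [] //= /andP[xy pp] lp [sp].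
exists y => //; apply/eqP; rewrite eqn_leq; apply/andP; split.
  by apply: gdist_le; exists p.
by rewrite -ltnS -dx gdist_edge_le.
Qed.

Definition joined (A : pred V) x y :=
  exists p, [/\ path E x p, last x p = y & all A (x :: p)].

Lemma joined_trans A x y z : joined A x y -> joined A y z -> joined A x z.
Proof.
move=> [p [pp lp ap]] [s [ps ls /= /andP[_ As]]]; exists (p ++ s).
by rewrite cat_path last_cat pp lp ps ls /= all_cat andbA As andbT.
Qed.

Lemma joined_sym A x y : joined A x y -> joined A y x.
Proof.
move=> [p [pp <- ap]]; exists (rev (belast x p)); rewrite rev_path; split.
- by rewrite (eq_path (e' := E)) // => a b /=; rewrite Esym.
- by case: p {pp ap} => //= a p; rewrite rev_cons last_rcons.
- by rewrite -[_ :: _]rev_rcons -lastI all_rev.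
Qed.

Lemma joined_sub (A B : pred V) x y :
  (forall z, A z -> B z) -> joined A x y -> joined B x y.
Proof. by move=> AB [p [pp lp ap]]; exists p; split=> //; apply: sub_all ap. Qed.

(** A path from y to y' avoiding their common neighbour x would close up,
    after removal of its loops, to a cycle through x. *)
Lemma neighbours_not_joined x y y' : E x y -> E x y' ->
  joined (predC1 x) y y' -> y = y'.
Proof.
move=> xy xy' [p [pp lp ap]]; apply/eqP; apply/negP => /negP yy'.
case/shortenP: pp lp ap => s ps us ss lp /= /andP[yx ap].
have xs : x \notin s.
  by apply/negP => /ss; move/allP: ap => /[apply] /=; rewrite eqxx.
have [_ _ _ /(_ [:: x, y & s])] := tE.
have cyc : ucycle E [:: x, y & s].
  rewrite /ucycle /= rcons_path xy ps lp [E y' x]Esym xy' /= in_cons negb_or.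
  by rewrite eq_sym yx xs; move: us => /= ->.
move=> /(_ cyc) /=; case: s {cyc} ps us ss lp xs => //= _ _ _ lp.
by rewrite lp eqxx in yy'.
Qed.

(** A geodesic is such a path, since its vertices approach z. *)
Lemma joined_geodesic y z :
  joined [pred v | (gdist E v z <= gdist E y z)%N] y z.
Proof.
have [n] := ubnP (gdist E y z); elim: n y => // n IH y.
case dy: (gdist E y z) => [|k] ltn.
  by rewrite (gdist_eq0 dy); exists [::]; rewrite /= gdistxx.
have [v yv dv] := gdist_step dy.
have := IH v; rewrite dv => /(_ ltn)[p [pp lp ap]].
exists (v :: p); rewrite /= yv pp lp; split=> //.
move: ap => /= /andP[_ ap]; rewrite dy dv leqnn leqnSn /=.
by apply: sub_all ap => u /= /leq_trans; apply.
Qed.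

(** Geodesics to z from two neighbours of x closer to z avoid x. *)
Lemma closer_unique x y y' z : E x y -> E x y' ->
  gdist E x z = (gdist E y z).+1 -> gdist E x z = (gdist E y' z).+1 -> y = y'.
Proof.
move=> xy xy' dy dy'; apply: (neighbours_not_joined xy xy').
apply: (@joined_trans _ _ z).
  apply: joined_sub (joined_geodesic y z) => v /=.
  by apply: contraTneq => ->; rewrite dy ltnn.
apply/joined_sym; apply: joined_sub (joined_geodesic y' z) => v /=.
by apply: contraTneq => ->; rewrite dy' ltnn.
Qed.

(** Trees are bipartite: for adjacent x, y equidistant from z, the geodesics to
    z would join y, avoiding x, to the second vertex of the geodesic from x. *)
Lemma gdist_neighbour x y z : E x y -> gdist E x z <> gdist E y z.
Proof.
move=> xy dxy; case dx: (gdist E x z) (dxy) => [|n].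
  by move=> /esym/gdist_eq0 yz; move: xy; rewrite (gdist_eq0 dx) yz Eirr.
move=> /esym dy; have [x' xx' dx'] := gdist_step dx; have [y' yy' dy'] := gdist_step dy.
suff yx' : y = x' by move: dx'; rewrite -yx' dy; lia.
apply: (neighbours_not_joined xy xx').
apply: (@joined_trans _ _ y').
  exists [:: y']; rewrite /= yy'; split=> //; rewrite andbT; apply/andP; split.
    by apply: contraTneq xy => ->; rewrite Eirr.
  by apply/eqP => e; move: dx; rewrite -e dy'; lia.
apply: (@joined_trans _ _ z).
  apply: joined_sub (joined_geodesic y' z) => v /=.
  by apply: contraTneq => ->; rewrite dx dy' ltnn.
apply/joined_sym; apply: joined_sub (joined_geodesic x' z) => v /=.
by apply: contraTneq => ->; rewrite dx dx' ltnn.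
Qed.

Section Busemann.
Variable r0 : nat -> V.
Hypothesis gr0 : geodesic_ray E r0.

Let D x m : int := (gdist E x (r0 m))%:Z - m%:Z.

Let D_mono x m n : (m <= n)%N -> D x n <= D x m.
Proof.
move=> mn; have := gdist_triangle (r0 m) x (r0 n).
by have := gr0 m (n - m)%N; rewrite subnKC // /D => ->; lia.
Qed.

(** The Busemann function of the end of r0: the eventual value of the
    non-increasing integer sequence d(x, r0 m) - m. *)
Definition bus x : int :=
  xget 0 [set k : int | exists M, forall m, (M <= m)%N -> D x m = k].

Let bus_ex x : exists M, forall m, (M <= m)%N -> D x m = bus x.
Proof.
suff ex : exists k : int, exists M, forall m, (M <= m)%N -> D x m = k.
  rewrite /bus; case: xgetP => [k _ //|nex]; exfalso.
  by case: ex => k Hk; apply: (nex k).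
have lb m : 0 <= D x m + (gdist E x (r0 0%N))%:Z.
  have := gdist_triangle x (r0 0%N) (r0 m); have := gr0 0 m.
  by rewrite add0n /D (gdistC (r0 0%N) x) => ->; lia.
pose c m := absz (D x m + (gdist E x (r0 0%N))%:Z).
have cE m : (c m)%:Z = D x m + (gdist E x (r0 0%N))%:Z by rewrite gez0_abs.
have exb : exists k, `[< exists m, c m = k >].
  by exists (c 0%N); apply/asboolP; exists 0%N.
case: (ex_minnP exb) => k /asboolP[M Mk] mink.
exists (D x M), M => m Mm; apply/eqP; rewrite eq_le D_mono //=.
have : (k <= c m)%N by apply: mink; apply/asboolP; exists m.
by have := cE m; have := cE M; lia.
Qed.

Lemma bus_near x : exists M, forall m, (M <= m)%N ->
  (gdist E x (r0 m))%:Z = bus x + m%:Z.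
Proof. by have [M HM] := bus_ex x; exists M => m /HM <-; rewrite /D subrK. Qed.

Lemma bus_le x m : bus x <= (gdist E x (r0 m))%:Z - m%:Z.
Proof.
have [M HM] := bus_ex x; rewrite -(HM (maxn M m)) ?leq_maxl //.
by apply: D_mono; rewrite leq_maxr.
Qed.

Lemma bus_edge x y : E x y -> bus x = bus y + 1 \/ bus y = bus x + 1.
Proof.
move=> xy; have yx : E y x by rewrite Esym.
have [M HM] := bus_near x; have [M' HM'] := bus_near y.
have := HM (M + M')%N; have := HM' (M + M')%N.
have := gdist_edge_le (r0 (M + M')%N) xy; have := gdist_edge_le (r0 (M + M')%N) yx.
by have := gdist_neighbour (z := r0 (M + M')%N) xy; lia.
Qed.

Lemma bus_lip x y : bus x <= bus y + (gdist E x y)%:Z.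
Proof.
have [M HM] := bus_near x; have [M' HM'] := bus_near y.
have := HM (M + M')%N; have := HM' (M + M')%N.
by have := gdist_triangle y x (r0 (M + M')%N); lia.
Qed.

(** The first vertex y of a geodesic from x to a remote vertex of r0 is the
    only neighbour at which the Busemann function is smaller. *)
Lemma bus_step x m : (0 < gdist E x (r0 m))%N ->
  (gdist E x (r0 m))%:Z = bus x + m%:Z ->
  exists y, [/\ E x y, bus x = bus y + 1 & (gdist E y (r0 m))%:Z = bus y + m%:Z].
Proof.
case dx: (gdist E x (r0 m)) => [//|n] _ hx.
have [y xy dy] := gdist_step dx; exists y; have := bus_le y m.
by have [] := bus_edge xy; rewrite dy; split=> //; lia.
Qed.

Lemma bus_ray m : bus (r0 m) = - m%:Z.
Proof.
have [M HM] := bus_near (r0 m); have := HM (m + M)%N; rewrite gr0; lia.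
Qed.

Definition parent x : V := xget x [set y | E x y /\ bus x = bus y + 1].

Lemma parentP x : E x (parent x) /\ bus x = bus (parent x) + 1.
Proof.
rewrite /parent; case: xgetP => [y _ //|nex]; exfalso.
have [M HM] := bus_near x.
have Hm : (M <= M + `|bus x|%N + 1)%N by lia.
have dx := HM _ Hm; have d_gt0 : (0 < gdist E x (r0 (M + `|bus x| + 1)))%N by lia.
by have [y [? ? _]] := bus_step d_gt0 dx; apply: (nex y).
Qed.

Lemma parent_unique x y : E x y -> bus x = bus y + 1 -> y = parent x.
Proof.
move=> xy bxy; have [xp bxp] := parentP x.
have [M HM] := bus_near x; have [M' HM'] := bus_near y.
have [N HN] := bus_near (parent x); pose m := (M + M' + N)%N.
have h1 := HM m; have h2 := HM' m; have h3 := HN m.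
by apply: (@closer_unique x y _ (r0 m)) => //; lia.
Qed.

Lemma parent_edge x y : E x y = (y == parent x) || (x == parent y).
Proof.
apply/idP/orP => [xy|[/eqP->|/eqP->]]; last 2 first.
- by case: (parentP x).
- by rewrite Esym; case: (parentP y).
have [b|b] := bus_edge xy; first by left; apply/eqP/parent_unique.
by right; apply/eqP/parent_unique; rewrite // Esym.
Qed.

Lemma bus_parent x : bus (parent x) = bus x - 1.
Proof. by have [_ ->] := parentP x; rewrite addrK. Qed.

Lemma bus_iter n x : bus (iter n parent x) = bus x - n%:Z.
Proof. by elim: n => [|n IH] /=; rewrite ?subr0 // bus_parent IH; lia. Qed.

Lemma gdist_iter n x : gdist E x (iter n parent x) = n.
Proof.
apply/eqP; rewrite eqn_leq; apply/andP; split; last first.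
  by have := bus_lip x (iter n parent x); rewrite bus_iter; lia.
elim: n => [|n IH] /=; first by rewrite gdistxx.
apply: leq_trans (gdist_triangle (iter n parent x) _ _) _.
rewrite -addn1 leq_add // gdist_le //; apply: walk_edge.
by case: (parentP (iter n parent x)).
Qed.

Lemma parent_ray m : r0 m.+1 = parent (r0 m).
Proof.
apply: parent_unique; last by rewrite !bus_ray; lia.
have d1 : gdist E (r0 m) (r0 m.+1) = 1%N by rewrite -(addn1 m) gr0.
by have [y xy /gdist_eq0 <-] := gdist_step d1.
Qed.

Lemma iter_parent_ray n m : r0 (n + m)%N = iter n parent (r0 m).
Proof. by elim: n => //= n IH; rewrite addSn parent_ray IH. Qed.

(** For m so large that d(x, r0 m) = bus x + m, a geodesic from x to r0 m consists
    of parents. *)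
Lemma meets_ray x : exists n m, iter n parent x = r0 m.
Proof.
have [M HM] := bus_near x; pose m := (M + `|bus x|)%N.
have dx : (gdist E x (r0 m))%:Z = bus x + m%:Z by apply: HM; rewrite leq_addr.
exists (gdist E x (r0 m)), m; apply: gdist_eq0.
move: dx; move: m => m {M HM}.
have [n] := ubnP (gdist E x (r0 m)); elim: n x => // n IH x.
case d: (gdist E x (r0 m)) => [|k] ltn dx //=.
have [||y [xy bxy dy]] := @bus_step x m; rewrite ?d //.
rewrite -iterS iterSr -(parent_unique xy bxy).
have ek : gdist E y (r0 m) = k by lia.
by have := IH y; rewrite ek; apply => //; lia.
Qed.

Lemma common_ancestor x y : exists n m, iter n parent x = iter m parent y.
Proof.
have [n [m e]] := meets_ray x; have [n' [m' e']] := meets_ray y.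
exists (m' + n)%N, (m + n')%N; rewrite !iterD e e' -!iter_parent_ray.
by rewrite addnC.
Qed.

Lemma parent_geodesic s : (forall n, s n.+1 = parent (s n)) -> geodesic_ray E s.
Proof.
move=> ps i n; suff -> : s (i + n)%N = iter n parent (s i) by rewrite gdist_iter.
by elim: n => [|n IH]; rewrite ?addn0 // addnS ps IH.
Qed.

Lemma geodesic_inj s : geodesic_ray E s -> injective s.
Proof.
move=> gs i j; wlog ij : i j / (i <= j)%N => [H|].
  by have [/H//|/ltnW/H {}H /esym/H] := leqP i j.
by move=> e; have := gs i (j - i)%N; rewrite subnKC // -e gdistxx; lia.
Qed.

(** A geodesic ray equivalent to r0 meets r0 in vertices r0 m with m
    arbitrarily large, and the Busemann function decreases along it. *)
Lemma equiv_ray_parent s : geodesic_ray E s -> ray_equiv r0 s ->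
  forall n, s n.+1 = parent (s n).
Proof.
move=> gs rs n.
have [M HM] := bus_near (s n); have [M' HM'] := bus_near (s n.+1).
have [i [m [ni Mm e]]] : exists i m, [/\ (n < i)%N, (M + M' <= m)%N & s i = r0 m].
  apply: contrapT => nex.
  have : finite_set (range s).
    pose F := (range r0 `+` range s) `|` (s @` `I_n.+1) `|` (r0 @` `I_(M + M')).
    apply: (@sub_finite_set _ _ F); last first.
      rewrite /F 2!finite_setU; split; first split=> //.
      - by apply/finite_image/finite_II.
      - by apply/finite_image/finite_II.
    move=> _ [i _ <-]; rewrite /F.
    have [[m _ e]|nr] := pselect (range r0 (s i)); last first.
      by left; left; right; split=> //; exists i.
    have [lt|ge] := ltnP n i; last by left; right; exists i.
    right; exists m; rewrite //=; have [//|ge] := ltnP m (M + M').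
    by case: nex; exists i, m.
  rewrite (eq_finite_set (inj_card_eq _)); first exact: infinite_nat.
  by move=> a b _ _; apply: geodesic_inj.
apply: parent_unique.
  have d1 : gdist E (s n) (s n.+1) = 1%N by rewrite -(addn1 n) gs.
  by have [y xy /gdist_eq0 <-] := gdist_step d1.
have := HM m; have := HM' m; rewrite -e.
have := gs n (i - n)%N; have := gs n.+1 (i - n.+1)%N.
by rewrite (subnKC ni) (subnKC (ltnW ni)); lia.
Qed.

Lemma parent_equiv_ray s : (forall n, s n.+1 = parent (s n)) -> ray_equiv r0 s.
Proof.
move=> ps; have [n [m e]] := meets_ray (s 0%N).
have si k : s k = iter k parent (s 0%N) by elim: k => // k IH; rewrite ps IH.
have snm k : s (k + n)%N = r0 (k + m)%N by rewrite si iterD e iter_parent_ray.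
apply: (@sub_finite_set _ _ ((r0 @` `I_m) `|` (s @` `I_n))).
  move=> v [[[i _ <-] nv]|[[i _ <-] nv]].
    left; exists i => //=; have [//|mi] := ltnP i m; case: nv.
    by exists (i - m + n)%N => //; rewrite snm subnK.
  right; exists i => //=; have [//|ni] := ltnP i n; case: nv.
  by exists (i - n + m)%N => //; rewrite -snm subnK.
by rewrite finite_setU; split; apply/finite_image/finite_II.
Qed.

End Busemann.
End TreeDistance.

(** * Parents, heights and successors *)

Section TreeStructure.
Variables (q : nat) (T : tree q).

Definition base_ray : nat -> T := s2val (cid2 (tree_end T)).

Definition par (x : T) : T := parent (@edge q T) base_ray x.

Let tT := tree_tree T.
Let gb : geodesic_ray (@edge q T) base_ray.
Proof. exact: (s2valP (cid2 (tree_end T))). Qed.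

Lemma omegaP (s : nat -> T) : @omega q T s <-> forall n, s n.+1 = par (s n).
Proof.
rewrite (s2valP' (cid2 (tree_end T))) -/base_ray; split.
  by move=> [gs es]; apply: equiv_ray_parent es.
by move=> ps; split; [apply: parent_geodesic ps | apply: parent_equiv_ray ps].
Qed.

Lemma ray_toP (x : T) (r : nat -> T) :
  ray_to (@omega q T) x r <-> r = (fun n => iter n par x).
Proof.
split=> [[/omegaP rp r0]|->]; last by split=> //; apply/omegaP.
by apply/funext; elim=> //= n IH; rewrite rp IH.
Qed.

Lemma predecE (x : T) : predec (@omega q T) x = par x.
Proof.
rewrite /predec; case: xgetP => [y _ [r /ray_toP -> //]|/(_ (par x))[]].
by exists (fun n => iter n par x) => //; apply/ray_toP.
Qed.

Lemma ancestorP (x y : T) : ancestor x y <-> exists n, x = iter n par y.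
Proof.
split=> [[r /ray_toP -> [n _ <-]]|[n ->]]; first by exists n.
by exists (fun n => iter n par y); [apply/ray_toP | exists n].
Qed.

Lemma common_par (x y : T) : exists n m, iter n par x = iter m par y.
Proof. exact: common_ancestor. Qed.

Lemma confluentP (x y : T) : exists n m,
  confluent (@omega q T) x y = iter n par x /\ confluent (@omega q T) x y = iter m par y.
Proof.
rewrite /confluent; case: xgetP => [c _ [/ancestorP[n ?] /ancestorP[m ?] _]|nex].
  by exists n, m.
have exb : exists n, `[< ancestor (iter n par x) y >].
  have [n [m e]] := common_par x y; exists n; apply/asboolP/ancestorP; exists m.
  by rewrite e.
case: (ex_minnP exb) => n /asboolP an minn; exfalso.
apply: (nex (iter n par x)); split=> //; first by apply/ancestorP; exists n.
move=> c /ancestorP[k ->] ay; apply/ancestorP; exists (k - n)%N.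
by rewrite -iterD subnK // minn //; apply/asboolP.
Qed.

(** If x and the origin o have the confluent p^n x = p^m o, then both sides are
    n - m. *)
Lemma heightE (x : T) :
  height x = bus (@edge q T) base_ray x - bus (@edge q T) base_ray (origin T).
Proof.
rewrite /height /busemann; have [n [m [e e']]] := confluentP x (origin T).
rewrite {1}e e' !(gdist_iter tT gb).
have := bus_iter tT gb n x; have := bus_iter tT gb m (origin T).
by rewrite -[iter n _ _]e -[iter m _ _]e'; lia.
Qed.

Lemma height_par (x : T) : height (par x) = height x - 1.
Proof. by rewrite !heightE bus_parent //; lia. Qed.

Lemma height_iter n (x : T) : height (iter n par x) = height x - n%:Z.
Proof. by rewrite !heightE bus_iter //; lia. Qed.

Lemma edge_par (x y : T) : edge x y = (y == par x) || (x == par y).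
Proof. exact: parent_edge. Qed.

Lemma is_succP (x y : T) : is_succ x y <-> par y = x.
Proof.
rewrite /is_succ /succ_of predecE edge_par; split=> [[/orP[/eqP->|/eqP->]]|<-] //.
rewrite eqxx orbT; split=> // /(congr1 (@height q T)).
by rewrite !height_par; lia.
Qed.

Definition child (x : T) (l : 'I_q) : T := xget x [set y | par y = x /\ lab x y = l].

(** The q successors of x have distinct labels among q, hence all labels occur. *)
Lemma childP (x : T) l : par (child x l) = x /\ lab x (child x l) = l.
Proof.
suff [y] : exists y, par y = x /\ lab x y = l.
  by rewrite /child; case: xgetP => [? _ [] //|nex /(nex _)].
have /card_set_bijP[r [rfun rinj rsurj]] := tree_regular x.
have /choice[f fP] : forall k : 'I_q.+1, exists y, edge x y /\ r y = k.
  by move=> k; have [|y xy <-] := rsurj k; rewrite /= ?ltn_ord //; exists y.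
have finj : injective f.
  by move=> k k' e; apply/val_inj => /=; have [_ <-] := fP k; have [_ <-] := fP k'; rewrite e.
have xp : edge x (par x) by rewrite edge_par eqxx.
have rp : (r (par x) < q.+1)%N by exact: rfun xp.
pose i0 : 'I_q.+1 := Ordinal rp.
have fi0 : f i0 = par x.
  by have [xf e] := fP i0; apply: rinj; rewrite ?inE.
pose y j := f (lift i0 j).
have yx j : par (y j) = x.
  have : edge x (y j) by case: (fP (lift i0 j)).
  rewrite edge_par => /orP[|/eqP//]; rewrite -fi0 => /eqP/finj e.
  by have := neq_lift i0 j; rewrite e eqxx.
have inj : injective (fun j => lab x (y j)).
  move=> j j' e; have : y j = y j'.
    by apply: tree_lab_inj e; apply/is_succP.
  by move=> /finj/lift_inj.
by have [g gK Kg] := injF_bij inj; exists (y (g l)); rewrite Kg.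
Qed.

Lemma par_child (x : T) l : par (child x l) = x.
Proof. by case: (childP x l). Qed.

Lemma lab_child (x : T) l : lab x (child x l) = l.
Proof. by case: (childP x l). Qed.

Lemma child_lab (y : T) : child (par y) (lab (par y) y) = y.
Proof.
by apply: (@tree_lab_inj _ _ (par y)); rewrite ?lab_child //;
   apply/is_succP; rewrite ?par_child.
Qed.

Lemma child_inj (x : T) : injective (child x).
Proof. by move=> l l' e; rewrite -(lab_child x l) e lab_child. Qed.

Lemma height_child (x : T) l : height (child x l) = height x + 1.
Proof. by rewrite -{2}(par_child x l) height_par subrK. Qed.

Lemma height_surj (k : int) : (0 < q)%N -> exists x : T, height x = k.
Proof.
move=> q_gt0; have h0 : height (origin T) = 0 by rewrite heightE subrr.
case: k => n.
  exists (iter n (child^~ (Ordinal q_gt0)) (origin T)).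
  by elim: n => //= n IH; rewrite height_child IH; lia.
by exists (iter n.+1 par (origin T)); rewrite height_iter h0; lia.
Qed.

End TreeStructure.

(** * Square-summable functions without infinite sums *)

Section SqrMod.
Variable R : realType.
Local Notation C := R[i].
Implicit Types (a b z : C).

Lemma sqr_mod_ge0 z : 0 <= sqr_mod z.
Proof. by rewrite addr_ge0 // sqr_ge0. Qed.

Lemma sqr_mod0 : sqr_mod (0 : C) = 0.
Proof. by rewrite /sqr_mod /= expr0n addr0. Qed.

Lemma sqr_mod_eq0 z : sqr_mod z = 0 -> z = 0.
Proof.
case: z => a b; rewrite /sqr_mod /= => /eqP.
by rewrite paddr_eq0 ?sqr_ge0 // !sqrf_eq0 => /andP[/eqP-> /eqP->].
Qed.

Lemma sqr_modM a b : sqr_mod (a * b) = sqr_mod a * sqr_mod b.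
Proof. by case: a b => [a a'] [b b']; rewrite /sqr_mod /=; ring. Qed.

Lemma sqr_modN a : sqr_mod (- a) = sqr_mod a.
Proof. by case: a => [a a']; rewrite /sqr_mod /= !sqrrN. Qed.

Lemma sqr_modD a b : sqr_mod (a + b) <= 2 * sqr_mod a + 2 * sqr_mod b.
Proof.
case: a b => [a a'] [b b']; rewrite /sqr_mod /=.
by have := sqr_ge0 (a - b); have := sqr_ge0 (a' - b'); nra.
Qed.

Lemma sqr_modC (r : R) : sqr_mod r%:C = r ^+ 2.
Proof. by rewrite /sqr_mod /= expr0n addr0. Qed.

Lemma sqr_mod_conj z : (sqr_mod z)%:C = z * z^*.
Proof. by rewrite -normCK add_Re2_Im2. Qed.

Lemma sqr_mod_cauchy (u v : C) (k : R) : 0 <= k ->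
  sqr_mod (u - v) <= k ^+ 2 -> complex.Re u <= complex.Re v + k /\ complex.Im u <= complex.Im v + k.
Proof.
case: u v => [a a'] [b b'] k0; rewrite /sqr_mod /= => le.
by split; rewrite -lerBlDl; apply: le_trans (ler_norm _) _;
  rewrite -(@ler_pXn2r _ 2) ?nnegrE // real_normK ?num_real //;
  apply: le_trans le; rewrite ?lerDl ?lerDr sqr_ge0.
Qed.

Lemma exp2_small (e : R) : 0 < e -> exists n, 2 ^- n < e.
Proof.
move=> e0; exists (Num.Def.archi_bound e^-1).
by rewrite -[ltRHS]invrK ltf_pV2 ?posrE ?invr_gt0 ?exprn_gt0 // upper_nthrootP.
Qed.

Lemma exp2N_gt0 n : 0 < 2 ^- n :> R.
Proof. by rewrite invr_gt0 exprn_gt0. Qed.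

Lemma exp2N_sqr_le n : (2 ^- n) ^+ 2 <= 2 ^- n :> R.
Proof.
rewrite expr2 ger_pMl ?exp2N_gt0 // invf_le1 ?exprn_gt0 //.
by rewrite exprn_ege1 // ler1n.
Qed.

Lemma le0_exp2 (a K : R) : (forall n, a <= K * 2 ^- n) -> a <= 0.
Proof.
move=> H; rewrite leNgt; apply/negP => a0.
have K0 : 0 < `|K| + 1 by rewrite ltr_wpDl.
have [n] := exp2_small (divr_gt0 a0 K0); rewrite ltr_pdivlMr // mulrC.
rewrite ltNge => /negP; apply; apply: le_trans (H n) _.
rewrite ler_pM2r ?exp2N_gt0 //; apply: le_trans (ler_norm _) _.
by rewrite lerDl.
Qed.

End SqrMod.

Section L2.
Variables (R : realType) (X : choiceType).
Local Notation C := R[i].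
Implicit Types (f g u v : X -> C).

(** M bounds the square of the l2 norm of f, expressed by finite sums only. *)
Definition nbound f (M : R) :=
  forall s : seq X, uniq s -> \sum_(x <- s) sqr_mod (f x) <= M.

Lemma esum_le_nbound f M : nbound f M ->
  (\esum_(x in [set: X]) (sqr_mod (f x))%:E <= M%:E)%E.
Proof.
move=> fM; apply: ge_ereal_sup => _ [A [finA _] <-].
rewrite fsbig_finite //= sumEFin lee_fin.
exact/fM/finmap.fset_uniq.
Qed.

Lemma sum_le_esum (u : X -> R) (s : seq X) : uniq s ->
  ((\sum_(x <- s) u x)%:E <= \esum_(x in [set: X]) (u x)%:E)%E.
Proof.
move=> us; apply: esum_ge; exists [set` s]; first by split.
by rewrite -fsbig_seq // sumEFin.
Qed.

Lemma esum_sqr_mod_ge0 f : (0 <= \esum_(x in [set: X]) (sqr_mod (f x))%:E)%E.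
Proof. by apply: esum_ge0 => x _; rewrite lee_fin sqr_mod_ge0. Qed.

Lemma l2_nbound f M : nbound f M -> l2 f.
Proof. by move=> /esum_le_nbound/le_lt_trans; apply; rewrite ltry. Qed.

Lemma nbound_l2norm f : l2 f -> nbound f (l2norm f ^+ 2).
Proof.
move=> lf s us; have e0 := esum_sqr_mod_ge0 f.
rewrite /l2norm sqr_sqrtr ?fine_ge0 // -lee_fin fineK ?ge0_fin_numE //.
exact: (sum_le_esum (fun x => sqr_mod (f x))).
Qed.

Lemma l2norm_le f M : nbound f M -> l2norm f ^+ 2 <= M.
Proof.
move=> fM; have e0 := esum_sqr_mod_ge0 f; have lf := l2_nbound fM.
rewrite /l2norm sqr_sqrtr ?fine_ge0 // -lee_fin fineK ?ge0_fin_numE //.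
exact: esum_le_nbound.
Qed.

Lemma l2norm_ge0 f : 0 <= l2norm f.
Proof. exact: sqrtr_ge0. Qed.

Lemma nbound_le f M N : M <= N -> nbound f M -> nbound f N.
Proof. by move=> MN fM s us; apply: le_trans MN; apply: fM. Qed.

Lemma nbound_ext f g M : (forall x, f x = g x) -> nbound f M -> nbound g M.
Proof. by move=> fg; rewrite (_ : f = g) //; apply/funext. Qed.

Lemma nboundD f g M N : nbound f M -> nbound g N ->
  nbound (fun x => f x + g x) (2 * M + 2 * N).
Proof.
move=> fM gN s us; apply: (@le_trans _ _ (\sum_(x <- s)
    (2 * sqr_mod (f x) + 2 * sqr_mod (g x)))).
  by apply: ler_sum => x _; apply: sqr_modD.
by rewrite big_split /= -!mulr_sumr lerD // ler_pM2l ?ltr0n // ?fM ?gN.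
Qed.

Lemma nboundZ c f M : nbound f M -> nbound (fun x => c * f x) (sqr_mod c * M).
Proof.
move=> fM s us; under eq_bigr do rewrite sqr_modM.
by rewrite -mulr_sumr ler_wpM2l ?sqr_mod_ge0 ?fM.
Qed.

Lemma nboundN f M : nbound f M -> nbound (fun x => - f x) M.
Proof. by move=> fM s us; under eq_bigr do rewrite sqr_modN; apply: fM. Qed.

Lemma nboundB f g M N : nbound f M -> nbound g N ->
  nbound (fun x => f x - g x) (2 * M + 2 * N).
Proof. by move=> fM /nboundN; apply: nboundD. Qed.

Lemma nbound_point f M x : nbound f M -> sqr_mod (f x) <= M.
Proof. by move=> /(_ [:: x] isT); rewrite big_seq1. Qed.

Lemma nbound0 : nbound (fun=> 0) 0.
Proof. by move=> s _; rewrite big1 // => x _; rewrite sqr_mod0. Qed.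

Lemma nbound_eq0 f M : nbound f M -> M <= 0 -> f = fun=> 0.
Proof.
move=> fM M0; apply/funext => x; apply/sqr_mod_eq0/eqP.
by rewrite eq_le sqr_mod_ge0 andbT; apply: le_trans M0; apply: nbound_point.
Qed.

Lemma nbound_lim f M K : (forall n, nbound f (M + K * 2 ^- n)) -> nbound f M.
Proof.
move=> H s us; rewrite -subr_le0; apply: (@le0_exp2 _ _ K) => n.
by rewrite lerBlDl; apply: H.
Qed.

Lemma l2_lin c f g : l2 f -> l2 g -> l2 (fun x => c * f x + g x).
Proof.
move=> /nbound_l2norm/(nboundZ c) cf /nbound_l2norm lg.
exact: l2_nbound (nboundD cf lg).
Qed.

Lemma l2norm_lt f e : 0 < e -> nbound f (e ^+ 2 / 2) -> l2norm f < e.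
Proof.
move=> e0 /l2norm_le le; rewrite -(@ltr_pXn2r _ 2) ?nnegrE ?l2norm_ge0 ?ltW //.
by apply: le_lt_trans le _; have := exprn_gt0 2 e0; lra.
Qed.

(** s is a finite set whose partial sum is within e of the supremum that defines
    the infinite sum. *)
Lemma l2_tail f e : l2 f -> 0 < e -> exists s : seq X, uniq s /\
  nbound (fun x => if x \in s then 0 else f x) e.
Proof.
move=> lf e0; set S := (\esum_(x in [set: X]) (sqr_mod (f x))%:E)%E.
have Sfin : S \is a fin_num by rewrite ge0_fin_numE // esum_sqr_mod_ge0.
have : (S - e%:E < S)%E by rewrite lteBlDr // lteDl // lte_fin.
move=> /ereal_sup_gt[_ [A [finA _] <-]].
rewrite fsbig_finite //= sumEFin.
set s := (X in \sum_(_ <- X) _); move=> lt; exists s.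
have us : uniq s by exact: finmap.fset_uniq.
split=> // t ut; pose t' := [seq x <- t | x \notin s].
have ut' : uniq (s ++ t').
  rewrite cat_uniq us filter_uniq // andbT /=; apply/hasPn => x.
  by rewrite mem_filter => /andP[].
have := sum_le_esum (fun x => sqr_mod (f x)) ut'; rewrite big_cat /= -/S.
have -> : \sum_(x <- t') sqr_mod (f x) =
    \sum_(x <- t) sqr_mod (if x \in s then 0 else f x).
  rewrite big_filter [RHS](bigID (mem s)) /= [X in _ = X + _]big1 ?add0r; last first.
    by move=> x ->; rewrite sqr_mod0.
  by apply: eq_bigr => x /negbTE ->.
rewrite -(fineK Sfin) lee_fin; move: lt; rewrite -(fineK Sfin) -EFinB lte_fin.
by lra.
Qed.

Lemma rsum_finite (u : X -> R) (s : seq X) : uniq s ->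
  (forall x, x \notin s -> u x = 0) -> rsum u = \sum_(x <- s) u x.
Proof.
move=> us u0.
have H (v : X -> R) : (forall x, 0 <= v x) -> (forall x, x \notin s -> v x = 0) ->
    fine (\esum_(x in [set: X]) (v x)%:E) = \sum_(x <- s) v x.
  move=> v0 vs; rewrite [X in fine X](_ : _ = \esum_(x in [set` s]) (v x)%:E)%E.
    rewrite esum_fset //; last by move=> x _; rewrite lee_fin.
    by rewrite -fsbig_seq // sumEFin.
  rewrite [RHS]esum_mkcond; apply: eq_esum => x _.
  by case: ifPn => //; rewrite mem_setE => /vs ->.
rewrite /rsum !H; last first.
- by move=> x /u0 ->; rewrite maxxx.
- by move=> x; rewrite le_max lexx orbT.
- by move=> x /u0 ->; rewrite oppr0 maxxx.
- by move=> x; rewrite le_max lexx orbT.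
rewrite -sumrB; apply: eq_bigr => x _.
by case: (leP (u x) 0) => h; case: (leP (- u x) 0) => h'; lra.
Qed.

Lemma Re_sum (I : Type) (s : seq I) (F : I -> C) :
  complex.Re (\sum_(i <- s) F i) = \sum_(i <- s) complex.Re (F i).
Proof.
elim: s => [|i s IH]; rewrite ?big_nil // !big_cons -IH.
by case: (F i) => ? ?; case: (\sum_(_ <- _) _).
Qed.

Lemma Im_sum (I : Type) (s : seq I) (F : I -> C) :
  complex.Im (\sum_(i <- s) F i) = \sum_(i <- s) complex.Im (F i).
Proof.
elim: s => [|i s IH]; rewrite ?big_nil // !big_cons -IH.
by case: (F i) => ? ?; case: (\sum_(_ <- _) _).
Qed.

Lemma l2inner_finite f g (s : seq X) : uniq s ->
  (forall x, x \notin s -> f x * (g x)^* = 0) ->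
  l2inner f g = \sum_(x <- s) f x * (g x)^*.
Proof.
move=> us fg0; rewrite /l2inner !(@rsum_finite _ s) //; first last.
- by move=> x /fg0 ->.
- by move=> x /fg0 ->.
rewrite -Re_sum -Im_sum; by case: (\sum_(x <- s) _).
Qed.

(** Completeness of l2 along fast Cauchy sequences: the pointwise limits exist,
    and the bounds pass to the limit on each finite set. *)
Lemma nbound_complete (u : nat -> X -> C) (K : R) : 0 <= K ->
  (forall n m, nbound (fun x => u n x - u m x)
     (K ^+ 2 * ((2 ^- n) ^+ 2 + (2 ^- m) ^+ 2))) ->
  exists v, forall n, nbound (fun x => u n x - v x) (2 * K ^+ 2 * (2 ^- n) ^+ 2).
Proof.
move=> K0 Hu; have e0 n := @exp2N_gt0 R n.
have Huc n m x : complex.Re (u n x) <= complex.Re (u m x) + K * (2 ^- n + 2 ^- m) /\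
    complex.Im (u n x) <= complex.Im (u m x) + K * (2 ^- n + 2 ^- m).
  apply: sqr_mod_cauchy; first by rewrite mulr_ge0 // addr_ge0 // ltW.
  apply: le_trans (nbound_point x (Hu n m)) _.
  rewrite exprMn ler_wpM2l ?sqr_ge0 //.
  by have := e0 n; have := e0 m; nra.
have lims (c : nat -> R) : (forall n m, c n <= c m + K * (2 ^- n + 2 ^- m)) ->
    exists a, forall n, (c n - a) ^+ 2 <= (K * 2 ^- n) ^+ 2.
  move=> Hc; pose E := [set c n - K * 2 ^- n | n in [set: nat]].
  have ubE m : ubound E (c m + K * 2 ^- m).
    by move=> _ [n _ <-]; have := Hc n m; lra.
  have E0 : E !=set0 by exists (c 0%N - K * 2 ^- 0); exists 0%N.
  (* every c n - K 2^-n is at most every c m + K 2^-m *)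
  exists (sup E) => n.
  have h1 : c n - K * 2 ^- n <= sup E.
    by apply: ub_le_sup; [exists (c 0%N + K * 2 ^- 0); exact: ubE | exists n].
  have h2 : sup E <= c n + K * 2 ^- n by apply: ge_sup.
  by have := mulr_ge0 K0 (ltW (e0 n)); nra.
have /choice[v Hv] : forall x, exists z : C, forall n,
    sqr_mod (u n x - z) <= 2 * K ^+ 2 * (2 ^- n) ^+ 2.
  move=> x.
  have [a Ha] := lims _ (fun n m => proj1 (Huc n m x)).
  have [b Hb] := lims _ (fun n m => proj2 (Huc n m x)).
  exists (a +i* b) => n; have := Ha n; have := Hb n.
  by rewrite /sqr_mod; case: (u n x) => p r /=; rewrite !exprMn; lra.
exists v => n s us.
rewrite -subr_le0; apply: (@le0_exp2 _ _ (2 * K ^+ 2 + 4 * K ^+ 2 * (size s)%:R)) => m.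
suff : \sum_(x <- s) sqr_mod (u n x - v x) <=
    2 * K ^+ 2 * ((2 ^- n) ^+ 2 + (2 ^- m) ^+ 2) + 2 * (2 * K ^+ 2 * (2 ^- m) ^+ 2) * (size s)%:R.
  have le1 := exp2N_sqr_le R m.
  have := sqr_ge0 K; set k := K ^+ 2; set t := (2 ^- m) ^+ 2; set S := \sum_(_ <- _) _.
  have : 0 <= (size s)%:R :> R by rewrite ler0n.
  set l : R := (size s)%:R => l0 k0.
  have := mulr_ge0 k0 l0; move: le1; rewrite -/t; set r := 2 ^- m; nra.
apply: (@le_trans _ _ (\sum_(x <- s) (2 * sqr_mod (u n x - u m x) +
    2 * (2 * K ^+ 2 * (2 ^- m) ^+ 2)))).
  apply: ler_sum => x _.
  have -> : u n x - v x = (u n x - u m x) + (u m x - v x) by rewrite addrA subrK.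
  apply: le_trans (sqr_modD _ _) _; rewrite lerD2l ler_pM2l ?ltr0n //; exact: Hv.
rewrite big_split /= -mulr_sumr big_const_seq count_predT iter_addr_0.
rewrite -[_ *+ size s]mulr_natr lerD2r -(mulrA 2 (K ^+ 2)) ler_pM2l ?ltr0n //; exact: Hu.
Qed.

End L2.

(** * Closed linear spans *)

Section Spans.
Variables (R : realType) (X : choiceType) (S : set (X -> R[i])).
Local Notation C := R[i].
Implicit Types (f g u v : X -> C).

Definition comb (c : (X -> C) -> C) (s : seq (X -> C)) : X -> C :=
  fun x => \sum_(g <- s) c g * g x.

(** Combinations are taken over duplicate-free sequences, with the coefficients
    given by a function, so that orthonormality applies to them directly. *)
Definition span u := exists c s,
  [/\ uniq s, forall g, g \in s -> S g & u = comb c s].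

Definition cspan f := forall e : R, 0 < e ->
  exists2 u, span u & nbound (fun x => f x - u x) e.

Lemma comb_widen c (s t : seq (X -> C)) : uniq s -> uniq t -> {subset s <= t} ->
  comb c s = comb (fun g => if g \in s then c g else 0) t.
Proof.
move=> us ut st; apply/funext => x; rewrite /comb.
rewrite [RHS](bigID (mem s)) /= [X in _ = _ + X]big1; last first.
  by move=> g /negbTE ->; rewrite mul0r.
rewrite addr0 -big_filter.
rewrite (perm_big [seq g <- t | g \in s]) /=; last first.
  apply: uniq_perm; rewrite ?filter_uniq // filter_predT => g.
  by rewrite mem_filter; case: (boolP (g \in s)) => // /st ->.
by rewrite !big_filter; apply: eq_bigr => g ->.
Qed.

Lemma span_lin a u v : span u -> span v -> span (fun x => a * u x + v x).
Proof.
move=> [c [s [us sS ->]]] [c' [s' [us' sS' ->]]].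
pose t := undup (s ++ s').
have ut : uniq t by apply: undup_uniq.
exists (fun g => a * (if g \in s then c g else 0) + if g \in s' then c' g else 0), t.
split=> //.
  by move=> g; rewrite mem_undup mem_cat => /orP[/sS|/sS'].
rewrite (comb_widen c us ut); last by move=> g gs; rewrite mem_undup mem_cat gs.
rewrite (comb_widen c' us' ut); last by move=> g gs; rewrite mem_undup mem_cat gs orbT.
apply/funext => x; rewrite /comb mulr_sumr -big_split; apply: eq_bigr => g _ /=.
by rewrite mulrDl mulrA.
Qed.

Lemma span_gen g : S g -> span g.
Proof.
move=> Sg; exists (fun=> 1), [:: g]; split=> // [h|]; first by rewrite inE => /eqP ->.
by apply/funext => x; rewrite /comb big_seq1 mul1r.
Qed.

Lemma span0 : span (fun=> 0).
Proof. by exists (fun=> 0), [::]; split=> //; apply/funext => x; rewrite /comb big_nil. Qed.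

Lemma span_cspan u : span u -> cspan u.
Proof.
move=> su e e0; exists u => //; apply: nbound_le (ltW e0) _.
by rewrite (_ : (fun x => _) = fun=> 0); [exact: nbound0 | apply/funext => x; rewrite subrr].
Qed.

Lemma cspan_lim f : (forall e, 0 < e -> exists2 u, cspan u & nbound (fun x => f x - u x) e) ->
  cspan f.
Proof.
move=> H e e0; have e4 : 0 < e / 4 by rewrite divr_gt0.
have [u cu fu] := H _ e4; have [v sv uv] := cu _ e4; exists v => //.
have := nboundD fu uv; rewrite (_ : (fun x => _) = fun x => f x - v x).
  by apply: nbound_le; lra.
by apply/funext => x; rewrite addrA subrK.
Qed.

Lemma cspan_lin a f g : cspan f -> cspan g -> cspan (fun x => a * f x + g x).
Proof.
move=> cf cg e e0; pose k := 4 * (sqr_mod a + 1).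
have k0 : 0 < k by rewrite mulr_gt0 // ltr_wpDl ?sqr_mod_ge0.
have [u su fu] := cf _ (divr_gt0 e0 k0).
have [v sv gv] := cg (e / 4) (divr_gt0 e0 (ltr0n R 4)).
exists (fun x => a * u x + v x); first exact: span_lin.
have := nboundD (nboundZ a fu) gv.
rewrite (_ : (fun x => _) = fun x => a * f x + g x - (a * u x + v x)).
  apply: nbound_le; have k4 : sqr_mod a * (e / k) <= e / 4.
    rewrite /k invfM !mulrA ler_pdivrMr ?ltr_wpDl ?sqr_mod_ge0 //.
    by have := sqr_mod_ge0 a; nra.
  lra.
by apply/funext => x; ring.
Qed.

Lemma cspan0 : cspan (fun=> 0).
Proof. exact: span_cspan span0. Qed.

Lemma cspan_sum (I : eqType) (s : seq I) (c : I -> C) (F : I -> X -> C) :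
  (forall i, i \in s -> cspan (F i)) -> cspan (fun x => \sum_(i <- s) c i * F i x).
Proof.
elim: s => [|i s IH] cF.
  by rewrite (_ : (fun x => _) = fun=> 0); [exact: cspan0 | apply/funext => x; rewrite big_nil].
rewrite (_ : (fun x => _) = fun x => c i * F i x + \sum_(j <- s) c j * F j x).
  apply: cspan_lin; first by apply: cF; rewrite inE eqxx.
  by apply: IH => j js; apply: cF; rewrite inE js orbT.
by apply/funext => x; rewrite big_cons.
Qed.

Lemma span_sum u : span u -> exists (n : nat) (c : 'I_n -> C) (g : 'I_n -> X -> C),
  (forall i, S (g i)) /\ u = fun x => \sum_i c i * g i x.
Proof.
move=> [c [s [_ sS ->]]]; exists (size s).
exists (fun i => c (tnth (in_tuple s) i)), (tnth (in_tuple s)); split.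
  by move=> i; apply/sS/mem_tnth.
by apply/funext => x; rewrite /comb (big_tnth _ _ s).
Qed.

Lemma cspan_total : (forall f, l2 f -> cspan f) -> total_in_l2 S.
Proof.
move=> cS f lf e e0; have [|u su fu] := cS f lf (e ^+ 2 / 2).
  by rewrite divr_gt0 // exprn_gt0.
have [n [c [g [Sg eu]]]] := span_sum su; exists n, c, g; split=> //.
by have := l2norm_lt e0 fu; rewrite eu.
Qed.

(** Finitely supported functions are dense in l2. *)
Lemma delta_cspan : (forall x0, cspan (fun x => (x == x0)%:R)) ->
  forall f, l2 f -> cspan f.
Proof.
move=> dS f lf; apply: cspan_lim => e e0.
have [s [us fs]] := l2_tail lf e0.
exists (fun x => \sum_(y <- s) f y * (x == y)%:R); first by apply: cspan_sum => y _.
rewrite (_ : (fun x => _) = fun x => if x \in s then 0 else f x) //.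
apply/funext => x; case: ifPn => xs.
  rewrite (bigD1_seq x) //= eqxx mulr1 big1 ?addr0 ?subrr // => y.
  by rewrite eq_sym => /negbTE ->; rewrite mulr0.
rewrite big_seq big1 ?subr0 // => y ys; rewrite (_ : x == y = false) ?mulr0 //.
by apply: contraNF xs => /eqP ->.
Qed.

End Spans.

Lemma big_uniq_sub (V : nmodType) (I : eqType) (s t : seq I) (F : I -> V) :
  uniq s -> uniq t -> {subset s <= t} ->
  \sum_(i <- t) F i = \sum_(i <- s) F i + \sum_(i <- t | i \notin s) F i.
Proof.
move=> us ut st; rewrite (bigID (mem s)) /=; congr (_ + _).
rewrite -big_filter; apply: perm_big; apply: uniq_perm; rewrite ?filter_uniq // => i.
by rewrite mem_filter; case: (boolP (i \in s)) => // /st ->.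
Qed.

Lemma big_uniq_widen (V : nmodType) (I : eqType) (s t : seq I) (F : I -> V) :
  uniq s -> uniq t -> {subset s <= t} -> (forall i, i \notin s -> F i = 0) ->
  \sum_(i <- t) F i = \sum_(i <- s) F i.
Proof.
by move=> us ut st F0; rewrite (big_uniq_sub _ us ut st) [X in _ + X]big1 ?addr0.
Qed.

Lemma sum_uniq_le (R : realType) (I : eqType) (F : I -> R) (s t : seq I) :
  (forall x, 0 <= F x) -> uniq s -> uniq t -> {subset s <= t} ->
  \sum_(x <- s) F x <= \sum_(x <- t) F x.
Proof.
by move=> F0 us ut st; rewrite (big_uniq_sub _ us ut st) lerDl sumr_ge0.
Qed.

Lemma big_same_support (V : nmodType) (I : eqType) (s t : seq I) (F : I -> V) :
  uniq s -> uniq t -> (forall i, i \notin s -> F i = 0) -> (forall i, i \notin t -> F i = 0) ->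
  \sum_(i <- s) F i = \sum_(i <- t) F i.
Proof.
move=> us ut Fs Ft; have uu : uniq (undup (s ++ t)) by apply: undup_uniq.
rewrite -(big_uniq_widen us uu _ Fs); last by move=> i; rewrite mem_undup mem_cat => ->.
by apply: big_uniq_widen => // i; rewrite mem_undup mem_cat orbC => ->.
Qed.

Section FiniteSupport.
Variables (R : realType) (X : choiceType).

Lemma finite_nbound (f : X -> R[i]) (s : seq X) : uniq s -> (forall x, x \notin s -> f x = 0) ->
  nbound f (\sum_(x <- s) sqr_mod (f x)).
Proof.
move=> us s0 t ut; have uu : uniq (undup (s ++ t)) by apply: undup_uniq.
rewrite -(big_uniq_widen us uu); first last.
- by move=> x /s0 ->; rewrite sqr_mod0.
- by move=> x; rewrite mem_undup mem_cat => ->.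
apply: sum_uniq_le => // x; first exact: sqr_mod_ge0.
by rewrite mem_undup mem_cat orbC => ->.
Qed.

Lemma finite_l2 (f : X -> R[i]) (s : seq X) : uniq s ->
  (forall x, x \notin s -> f x = 0) -> l2 f.
Proof. by move=> us s0; apply: l2_nbound (finite_nbound us s0). Qed.

End FiniteSupport.

(** * Finite-range operators with a total family of eigenfunctions *)

Section Spectral.
Variables (R : realType) (X : choiceType) (S : set (X -> R[i])).
Local Notation C := R[i].
Variables (lam : (X -> C) -> C) (k : C) (nb : X -> seq X).
Hypothesis kreal : (k^*)%R = k.
Hypothesis nb_uniq : forall x, uniq (nb x).
Hypothesis nb_sym : forall x y, (y \in nb x) = (x \in nb y).
Implicit Types (f g u v : X -> C).

(** The simple random walk has this form, with the neighbours of x for nb x and the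
    reciprocal of the degree for k. The operator is called A in what follows. *)
Definition nbop f : X -> C := fun x => k * \sum_(y <- nb x) f y.

Hypothesis Sfin : forall g, S g -> exists2 s : seq X, uniq s & forall x, x \notin s -> g x = 0.
Hypothesis Sorth : forall f g, S f -> S g -> l2inner f g = (`[< f = g >])%:R.
Hypothesis Seig : forall g, S g -> nbop g = fun x => lam g * g x.
Hypothesis Stot : forall f, l2 f -> cspan S f.

Lemma nbop_lin a u v : nbop (fun x => a * u x + v x) = fun x => a * nbop u x + nbop v x.
Proof.
apply/funext => x; rewrite /nbop big_split /= -mulr_sumr; ring.
Qed.

Lemma nbop_comb c (s : seq (X -> C)) : (forall g, g \in s -> S g) ->
  nbop (comb c s) = comb (fun g => lam g * c g) s.
Proof.
move=> sS; apply/funext => x; rewrite /nbop /comb exchange_big mulr_sumr /= big_seq.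
rewrite [RHS]big_seq; apply: eq_bigr => g /sS /Seig /(congr1 (@^~ x)) /= e.
by rewrite -mulr_sumr mulrCA -/(nbop g x) e; ring.
Qed.

Lemma common_support (s : seq (X -> C)) : (forall g, g \in s -> S g) ->
  exists2 t : seq X, uniq t & forall g, g \in s -> forall x, x \notin t -> g x = 0.
Proof.
elim: s => [|g s IH] sS; first by exists [::].
have [|t ut t0] := IH; first by move=> h hs; apply: sS; rewrite inE hs orbT.
have [|t' ut' t0'] := @Sfin g; first by apply: sS; rewrite inE eqxx.
exists (undup (t ++ t')); first exact: undup_uniq.
move=> h; rewrite inE => /orP[/eqP ->|hs] x; rewrite mem_undup mem_cat negb_or => /andP[xt xt'].
  exact: t0'.
exact: t0 xt.
Qed.

Lemma inner_comb f c (s : seq (X -> C)) (t : seq X) :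
  \sum_(x <- t) f x * (comb c s x)^* = \sum_(g <- s) (c g)^* * \sum_(x <- t) f x * (g x)^*.
Proof.
under [RHS]eq_bigr do rewrite mulr_sumr.
rewrite [RHS]exchange_big; apply: eq_bigr => x _ /=.
rewrite /comb rmorph_sum mulr_sumr; apply: eq_bigr => g _.
by rewrite rmorphM /=; ring.
Qed.

Lemma comb_inner h c (s : seq (X -> C)) (t : seq X) :
  uniq s -> (forall g, g \in s -> S g) -> S h ->
  uniq t -> (forall x, x \notin t -> h x = 0) ->
  \sum_(x <- t) comb c s x * (h x)^* = if h \in s then c h else 0.
Proof.
move=> us sS Sh ut h0; under eq_bigr do rewrite mulr_suml.
rewrite exchange_big /=.
transitivity (\sum_(g <- s) c g * (g == h)%:R).
  rewrite big_seq [RHS]big_seq; apply: eq_bigr => g gs.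
  under eq_bigr do rewrite -mulrA.
  rewrite -mulr_sumr -(@l2inner_finite _ _ g h t) //.
    by rewrite (Sorth (sS _ gs) Sh); congr (_ * _%:R); congr nat_of_bool; apply/asboolP/eqP.
  by move=> x /h0 ->; rewrite rmorph0 mulr0.
case: ifPn => hs; last first.
  rewrite big_seq big1 // => g gs; rewrite (_ : g == h = false) ?mulr0 //.
  by apply: contraNF hs => /eqP <-.
rewrite (bigD1_seq h) //= eqxx mulr1 big1 ?addr0 // => g /negbTE ->.
by rewrite mulr0.
Qed.

Lemma pythagoras c (s : seq (X -> C)) (t : seq X) :
  uniq s -> (forall g, g \in s -> S g) ->
  uniq t -> (forall g, g \in s -> forall x, x \notin t -> g x = 0) ->
  \sum_(x <- t) sqr_mod (comb c s x) = \sum_(g <- s) sqr_mod (c g).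
Proof.
move=> us sS ut s0; apply: (@complexI R); rewrite !rmorph_sum /=.
under eq_bigr do rewrite sqr_mod_conj.
rewrite inner_comb big_seq [RHS]big_seq; apply: eq_bigr => g gs.
by rewrite comb_inner ?gs ?sqr_mod_conj 1?mulrC //; [apply: sS | apply: s0].
Qed.

(** Both sides are the sum of k f(y) conj (g x) over the pairs of neighbours x, y,
    of which t contains all those with g x non-zero. *)
Lemma nbop_symmetric f g (s : seq X) : uniq s -> (forall x, x \notin s -> g x = 0) ->
  exists t, [/\ uniq t, {subset s <= t} &
    \sum_(x <- t) nbop f x * (g x)^* = \sum_(x <- t) f x * (nbop g x)^*].
Proof.
move=> us g0; pose t := undup (s ++ flatten [seq nb x | x <- s]).
have ut : uniq t by apply: undup_uniq.
have st : {subset s <= t} by move=> x xs; rewrite mem_undup mem_cat xs.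
exists t; split=> //.
have nbt h x : (forall y, y \in nb x -> y \notin t -> h y = 0) ->
    \sum_(y <- nb x) h y = \sum_(y <- t) (y \in nb x)%:R * h y.
  move=> h0; rewrite [LHS](eq_big_seq (fun y => (y \in nb x)%:R * h y)); last first.
    by move=> y ->; rewrite mul1r.
  apply: big_same_support => // y.
    by move=> /negbTE ->; rewrite mul0r.
  by move=> yt; case: (boolP (y \in nb x)) => [/h0 ->|]; rewrite ?mulr0 ?mul0r.
transitivity (\sum_(x <- t) \sum_(y <- t) k * ((y \in nb x)%:R * f y * (g x)^*)).
  apply: eq_bigr => x _; have [xs|xs] := boolP (x \in s); last first.
    by rewrite g0 // rmorph0 mulr0 big1 // => y _; rewrite !mulr0.
  rewrite /nbop nbt ?mulr_sumr ?mulr_suml; last first.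
    move=> y ynb; rewrite mem_undup mem_cat negb_or => /andP[_ /negP[]].
    by apply/flattenP; exists (nb x) => //; apply: map_f.
  by apply: eq_bigr => y _; rewrite !mulrA.
rewrite exchange_big; apply: eq_bigr => x _ /=.
rewrite /nbop nbt; last by move=> y _ yt; apply: g0; apply: contra yt => /st.
rewrite rmorphM rmorph_sum /= kreal !mulr_sumr; apply: eq_bigr => y _.
by rewrite rmorphM /= rmorph_nat nb_sym; ring.
Qed.

(** Symmetry of the operator gives z <f, g> = <f, A g> for the eigenfunction f. *)
Lemma inner_eig f g z (s : seq X) : S g -> nbop f = (fun x => z * f x) ->
  uniq s -> (forall x, x \notin s -> g x = 0) ->
  (z - (lam g)^*) * \sum_(x <- s) f x * (g x)^* = 0.
Proof.
move=> Sg ef us g0; have [t [ut st]] := nbop_symmetric f us g0.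
rewrite ef Seig // => e.
rewrite -(big_uniq_widen us ut st); last by move=> x /g0 ->; rewrite rmorph0 mulr0.
apply/eqP; rewrite mulrBl subr_eq0; apply/eqP.
rewrite !mulr_sumr (eq_bigr (fun x => z * f x * (g x)^*)) ?e; last by move=> *; rewrite mulrA.
by apply: eq_bigr => x _; rewrite rmorphM /=; ring.
Qed.

(** The case f = g of the previous lemma. *)
Lemma eigenvalue_real g : S g -> ((lam g)^*)%R = lam g.
Proof.
move=> Sg; have [s us s0] := Sfin Sg.
have := inner_eig Sg (Seig Sg) us s0.
rewrite -l2inner_finite //; last by move=> x /s0 ->; rewrite mul0r.
by rewrite Sorth // asboolT // mulr1 => /eqP; rewrite subr_eq0 => /eqP.
Qed.

Lemma orthonormal_neq0 g : S g -> g <> fun=> 0.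
Proof.
move=> Sg g0; have [s us s0] := Sfin Sg; have := Sorth Sg Sg.
rewrite (l2inner_finite us); last by move=> x /s0 ->; rewrite mul0r.
rewrite asboolT // g0 big1 => [/esym/eqP|x _]; first by rewrite oner_eq0.
by rewrite mul0r.
Qed.

Lemma orthonormal_eigenfunction g : S g -> eigenfunction nbop (lam g) g.
Proof.
move=> Sg; have [s us s0] := Sfin Sg.
by split; [exact: finite_l2 s0 | exact: orthonormal_neq0 | exact: Seig].
Qed.

Lemma sqr_modB (a b : C) :
  sqr_mod (a - b) = sqr_mod a + sqr_mod b - 2 * complex.Re (a * b^*).
Proof. by case: a b => [a a'] [b b']; rewrite /sqr_mod /=; ring. Qed.

(** A function orthogonal to S is at least as far from the span of S as it is
    from 0. *)
Lemma orthogonal_eq0 f : l2 f ->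
  (forall g (s : seq X), S g -> uniq s -> (forall x, x \notin s -> g x = 0) ->
     \sum_(x <- s) f x * (g x)^* = 0) -> f = fun=> 0.
Proof.
move=> lf fS; apply: (@nbound_eq0 _ _ _ 0) => // s us.
apply/ler_addgt0Pr => e e0; rewrite add0r.
have [u [c [t [ut tS eu]]] fu] := Stot lf e0.
have [r ur r0] := common_support tS.
pose w := undup (s ++ r); have uw : uniq w by apply: undup_uniq.
have w0 g : g \in t -> forall x, x \notin w -> g x = 0.
  by move=> gt x; rewrite mem_undup mem_cat negb_or => /andP[_]; apply: r0.
apply: le_trans (sum_uniq_le (t := w) _ us uw _) _.
- by move=> x; exact: sqr_mod_ge0.
- by move=> x; rewrite mem_undup mem_cat => ->.
apply: le_trans (fu w uw); under [leRHS]eq_bigr do rewrite sqr_modB.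
rewrite sumrB -mulr_sumr -Re_sum [X in _ <= X - _]big_split /= eu inner_comb.
rewrite [X in complex.Re X](_ : _ = 0) /=; last first.
  by rewrite big_seq big1 // => g gt; rewrite fS ?mulr0 //; [apply: tS | apply: w0].
by rewrite mulr0 subr0 lerDl sumr_ge0 // => x _; exact: sqr_mod_ge0.
Qed.

Lemma eigenvalue_in_family f z : eigenfunction nbop z f -> exists2 g, S g & z = lam g.
Proof.
move=> [lf f0 ef]; apply: contrapT => nex; apply: f0.
apply: orthogonal_eq0 => // g s Sg us s0.
have /eqP := inner_eig Sg ef us s0; rewrite mulf_eq0 eigenvalue_real // subr_eq0.
by move=> /orP[/eqP e|/eqP //]; case: nex; exists g.
Qed.

Lemma point_spectrum_family z : point_spectrum nbop z <-> exists2 g, S g & z = lam g.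
Proof.
split=> [[f /eigenvalue_in_family //]|[g Sg ->]]; exists g; exact: orthonormal_eigenfunction.
Qed.

Lemma eigenfunctions_total : pure_point nbop.
Proof.
move=> f lf e e0; have [n [c [g [Sg fg]]]] := cspan_total Stot lf e0.
exists n, c, g; split=> // i; exists (lam (g i)); exact: orthonormal_eigenfunction.
Qed.

(** Distinct elements of an orthonormal family are linearly independent. *)
Lemma orthonormal_infinite_multiplicity z :
  (forall n, exists2 g : 'I_n -> X -> C, injective g & forall i, S (g i) /\ lam (g i) = z) ->
  infinite_multiplicity nbop z.
Proof.
move=> H n; have [g ginj gS] := H n; exists g; split.
  by move=> i; have [Sg <-] := gS i; exact: orthonormal_eigenfunction.
move=> c c0 i; have [Sgi _] := gS i; have [s us s0] := Sfin Sgi.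
have : \sum_(x <- s) (\sum_j c j * g j x) * (g i x)^* = 0.
  by rewrite big1 // => x _; rewrite c0 mul0r.
under eq_bigr do rewrite mulr_suml.
rewrite exchange_big /= (eq_bigr (fun j => c j * (j == i)%:R)) => [|j _].
  by rewrite (bigD1 i) //= eqxx mulr1 big1 ?addr0 // => j /negbTE ->; rewrite mulr0.
under eq_bigr do rewrite -mulrA.
rewrite -mulr_sumr -(@l2inner_finite _ _ (g j) (g i) s) //; last first.
  by move=> x /s0 ->; rewrite rmorph0 mulr0.
rewrite Sorth //; last by case: (gS j).
by congr (_ * _%:R); congr nat_of_bool; apply/asboolP/eqP => [/ginj|->].
Qed.

Lemma closureP (P : set C) (z : C) :
  closure (P : set (C : numFieldType)) z <->
  forall e : R, 0 < e -> exists2 w, P w & sqr_mod (z - w) < e.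
Proof.
have ballE (w : C) (e : R) : 0 < e -> (ball (z : (C : numFieldType)) e%:C) w <-> sqr_mod (z - w) < e ^+ 2.
  move=> e0; rewrite -ball_normE /ball_ /= normc_def ltcR.
  by rewrite -[in X in _ <-> X](@sqr_sqrtr _ (sqr_mod _)) ?sqr_mod_ge0 // ltr_pXn2r ?nnegrE ?sqrtr_ge0 ?ltW.
split=> [cz e e0|H B /nbhs_ballP[e /= e0 eB]].
  have r0 : 0 < Num.sqrt e by rewrite sqrtr_gt0.
  have [|w [Pw]] := cz (ball (z : (C : numFieldType)) (Num.sqrt e)%:C).
    by apply: nbhsx_ballx; rewrite /= ltcR.
  by move=> /ballE; rewrite sqr_sqrtr ?ltW // => /(_ r0); exists w.
have [r re r0] : exists2 r : R, e = r%:C & 0 < r.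
  case: e e0 {eB} => a b; rewrite ltcE /= => /andP[/eqP b0 a0]; exists a => //.
  by first [rewrite b0 | rewrite -b0].
have [w Pw zw] := H (r ^+ 2) (exprn_gt0 2 r0).
by exists w; split=> //; apply: eB; rewrite re; apply/ballE.
Qed.

Lemma comb_resolvent z (d : R) u : 0 < d -> (forall g, S g -> d <= sqr_mod (lam g - z)) ->
  span S u -> exists2 v, span S v & (fun x => nbop v x - z * v x) = u.
Proof.
move=> d0 dS [c [s [us sS ->]]].
exists (comb (fun g => (lam g - z)^-1 * c g) s).
  by exists (fun g => (lam g - z)^-1 * c g), s.
rewrite nbop_comb //; apply/funext => x; rewrite /comb mulr_sumr -sumrB big_seq [RHS]big_seq.
apply: eq_bigr => g /sS /dS gd; have nz : lam g - z != 0.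
  by apply: contraTneq gd => ->; rewrite sqr_mod0 -ltNge.
by rewrite -[RHS](mulVKf nz); ring.
Qed.

(** On a combination of the family, A - z multiplies the coefficients by numbers
    of squared modulus at least d; Pythagoras' theorem compares the norms. *)
Lemma span_lower_bound z (d : R) v K : 0 < d -> (forall g, S g -> d <= sqr_mod (lam g - z)) ->
  span S v -> nbound (fun x => nbop v x - z * v x) K -> nbound v (K / d).
Proof.
move=> d0 dS [c [s [us sS ->]]] Kb t ut.
have [r ur r0] := common_support sS.
pose w := undup (t ++ r); have uw : uniq w by apply: undup_uniq.
have w0 g : g \in s -> forall x, x \notin w -> g x = 0.
  by move=> gt x; rewrite mem_undup mem_cat negb_or => /andP[_]; apply: r0.
apply: le_trans (sum_uniq_le (t := w) _ ut uw _) _.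
- by move=> x; exact: sqr_mod_ge0.
- by move=> x; rewrite mem_undup mem_cat => ->.
have := Kb w uw; rewrite nbop_comb //.
rewrite (eq_bigr (fun x => sqr_mod (comb (fun g => (lam g - z) * c g) s x))); last first.
  move=> x _; congr sqr_mod; rewrite /comb mulr_sumr -sumrB; apply: eq_bigr => g _; ring.
rewrite !pythagoras // => le; rewrite ler_pdivlMr //; apply: le_trans le.
rewrite mulr_suml big_seq [leRHS]big_seq; apply: ler_sum => g /sS /dS gd.
by rewrite sqr_modM mulrC ler_wpM2r ?sqr_mod_ge0.
Qed.

(** A - z being of finite range, convergence in norm implies pointwise convergence
    of the images. *)
Lemma nbop_local z x : exists2 K : R, 0 <= K & forall v M, nbound v M ->
  sqr_mod (nbop v x - z * v x) <= K * M.
Proof.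
have [K K0 HK] : exists2 K : R, 0 <= K & forall v M, nbound v M ->
    sqr_mod (\sum_(y <- nb x) v y) <= K * M.
  elim: (nb x) => [|y s [K K0 HK]].
    by exists 0 => // v M _; rewrite big_nil sqr_mod0 mul0r.
  exists (2 + 2 * K) => [|v M vM]; first by rewrite addr_ge0 // mulr_ge0.
  rewrite big_cons; apply: le_trans (sqr_modD _ _) _.
  by have := HK v M vM; have := nbound_point y vM; lra.
exists (2 * (sqr_mod k * K) + 2 * sqr_mod z) => [|v M vM].
  by rewrite addr_ge0 // !mulr_ge0 // sqr_mod_ge0.
apply: le_trans (sqr_modD _ _) _; rewrite sqr_modN /nbop !sqr_modM.
have := ler_wpM2l (sqr_mod_ge0 k) (HK v M vM).
by have := ler_wpM2l (sqr_mod_ge0 z) (nbound_point x vM); nra.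
Qed.

(** Solving (A - z) u = f: the finite combinations of S approximating f are
    images of finite combinations, which form a Cauchy sequence because A - z
    is bounded below on the span of S. *)
Lemma solve_resolvent z (d : R) f : 0 < d -> (forall g, S g -> d <= sqr_mod (lam g - z)) ->
  l2 f -> exists2 u, (fun x => nbop u x - z * u x) = f &
    forall K, nbound f K -> nbound u (4 / d * K).
Proof.
move=> d0 dS lf; have e0 n : 0 < (2 ^- n) ^+ 2 :> R by rewrite exprn_gt0 // exp2N_gt0.
have /choice[v Hv] : forall n, exists v, span S v /\
    nbound (fun x => f x - (nbop v x - z * v x)) ((2 ^- n) ^+ 2).
  move=> n; have [w sw fw] := Stot lf (e0 n).
  have [v sv ev] := comb_resolvent d0 dS sw; exists v; split=> //.
  by apply: nbound_ext fw => x; rewrite -ev.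
pose K := Num.sqrt (2 / d).
have K2 : K ^+ 2 = 2 / d by rewrite sqr_sqrtr // divr_ge0 // ltW.
have nlin (a b : X -> C) : (fun x => nbop (fun y => a y - b y) x - z * (a x - b x)) =
    fun x => (nbop a x - z * a x) - (nbop b x - z * b x).
  have -> : (fun y => a y - b y) = fun y => (-1) * b y + a y.
    by apply/funext => y; rewrite mulN1r addrC.
  by rewrite nbop_lin; apply/funext => x; ring.
have [|n m|u Hu] := @nbound_complete _ _ v K; first exact: sqrtr_ge0.
  have [svn bn] := Hv n; have [svm bm] := Hv m.
  rewrite K2 mulrAC mulrDr; apply: (span_lower_bound d0 dS).
    have -> : (fun x => v n x - v m x) = fun x => (-1) * v m x + v n x.
      by apply/funext => x; rewrite mulN1r addrC.
    exact: span_lin.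
  by rewrite nlin addrC; apply: nbound_ext (nboundB bm bn) => x; ring.
exists u.
  apply/funext => x; apply/eqP; rewrite -subr_eq0; apply/eqP/sqr_mod_eq0/eqP.
  rewrite eq_le sqr_mod_ge0 andbT.
  have [L L0 HL] := nbop_local z x.
  apply: (@le0_exp2 _ _ (2 * (L * (2 * K ^+ 2)) + 2)) => n.
  have h1 := HL _ _ (Hu n); have [_ fn] := Hv n; have h2 := nbound_point x fn.
  have -> : nbop u x - z * u x - f x = - (nbop (fun y => v n y - u y) x - z * (v n x - u x))
      - (f x - (nbop (v n) x - z * v n x)).
    by rewrite (congr1 (@^~ x) (nlin _ _)) /=; ring.
  apply: le_trans (sqr_modD _ _) _; rewrite !sqr_modN.
  have le1 := exp2N_sqr_le R n.
  have LK : 0 <= L * (2 * K ^+ 2).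
    by apply: mulr_ge0 => //; apply: mulr_ge0 => //; exact: sqr_ge0.
  have := ler_wpM2l LK le1; move: h1 h2; rewrite /= mulrA; nra.
move=> M fM; apply: (@nbound_lim _ _ _ _ (12 / d)) => n.
have [svn bn] := Hv n.
have wn : nbound (fun x => nbop (v n) x - z * v n x) (2 * M + 2 * (2 ^- n) ^+ 2).
  by apply: nbound_ext (nboundB fM bn) => x; ring.
have := nboundB (span_lower_bound d0 dS svn wn) (Hu n).
rewrite (_ : (fun x => _) = u); last by apply/funext => x; ring.
apply: nbound_le; rewrite K2.
have le1 := exp2N_sqr_le R n.
have dV : 0 < d^-1 by rewrite invr_gt0.
by have := ler_wpM2l (ltW dV) le1; set t := (2 ^- n) ^+ 2; nra.
Qed.

(** If z is a limit of eigenvalues, a bounded inverse of A - z would contradict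
    g = (lam g - z) B g for eigenfunctions g with lam g close to z. Otherwise the
    solutions u of (A - z) u = f are unique, as z is no eigenvalue, and they define
    the inverse. *)
Lemma spectrum_closure : spectrum nbop = closure (point_spectrum nbop : set (C : numFieldType)).
Proof.
apply/seteqP; split=> z; last first.
  move=> /closureP cz [B [Bl2 Blin [M BM]] Binv].
  have M1 : 0 < M ^+ 2 + 1 by rewrite ltr_wpDl // sqr_ge0.
  have e0 : 0 < (M ^+ 2 + 1)^-1 by rewrite invr_gt0.
  have [w /point_spectrum_family[g Sg ->] lt] := cz _ e0.
  have [lg g0 eg] := orthonormal_eigenfunction Sg.
  have l0 : l2 (fun=> 0 : C) := l2_nbound (@nbound0 R X).
  have B0 : B (fun=> 0) = fun=> 0.
    have := Blin 1 _ _ l0 l0; rewrite (_ : (fun x => _) = fun=> 0).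
      move=> e; apply/funext => x; have := congr1 (@^~ x) e => /= /eqP.
      by rewrite mul1r -subr_eq subrr eq_sym => /eqP.
    by apply/funext => x; rewrite mul1r addr0.
  have [Bg _] := Binv g lg.
  have {}Bg x : (lam g - z) * B g x = g x.
    rewrite -[RHS](congr1 (@^~ x) Bg) /=.
    rewrite (_ : (fun y => nbop g y - z * g y) = fun y => (lam g - z) * g y + (fun=> 0) y).
      by rewrite Blin // B0 addr0.
    by apply/funext => y; rewrite eg addr0 mulrBl.
  apply: g0; apply: (nbound_eq0 (nbound_l2norm lg)).
  have := l2norm_le (nbound_ext Bg (nboundZ (lam g - z) (nbound_l2norm (Bl2 g lg)))).
  have le1 : l2norm (B g) ^+ 2 <= M ^+ 2 * l2norm g ^+ 2.
    rewrite -exprMn ler_pXn2r ?nnegrE ?l2norm_ge0 ?BM //.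
    by apply: le_trans (BM g lg); exact: l2norm_ge0.
  move: lt; rewrite -opprB sqr_modN; set t := sqr_mod _ => lt.
  have t0 : 0 <= t by exact: sqr_mod_ge0.
  have := ler_wpM2l t0 le1; set N := l2norm g ^+ 2 => h1 h2.
  have N0 : 0 <= N by exact: sqr_ge0.
  have h3 : t * (M ^+ 2 + 1) < 1 by rewrite -ltr_pdivlMr // mul1r.
  rewrite leNgt; apply/negP => N1; have := ltr_pM2r N1 (t * (M ^+ 2 + 1)) 1.
  by rewrite h3 mul1r; have := mulr_ge0 t0 N0; nra.
move=> zs; apply: contrapT => nc; apply: zs.
have [d d0 dS] : exists2 d : R, 0 < d & forall g, S g -> d <= sqr_mod (lam g - z).
  apply: contrapT => nd; apply: nc; apply/closureP => e e0.
  apply: contrapT => nw; apply: nd; exists e => // g Sg; rewrite leNgt; apply/negP => lt.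
  apply: nw; exists (lam g); last by rewrite -opprB sqr_modN.
  by apply/point_spectrum_family; exists g.
have inj u v : l2 u -> l2 v ->
    (forall x, nbop u x - z * u x = nbop v x - z * v x) -> u = v.
  move=> lu lv e; pose w := fun x => (-1) * v x + u x.
  have [w0|w0] := pselect (w = fun=> 0).
    apply/funext => x; have := congr1 (@^~ x) w0; rewrite /w /= mulN1r addrC => /eqP.
    by rewrite subr_eq0 => /eqP.
  have : eigenfunction nbop z w.
    split=> //; first exact: l2_lin.
    rewrite nbop_lin; apply/funext => x; have := e x; rewrite /w => ex.
    have -> : nbop u x = nbop v x - z * v x + z * u x by rewrite -ex subrK.
    by ring.
  move=> /eigenvalue_in_family[g Sg ez]; have := dS g Sg.
  by rewrite -ez subrr sqr_mod0 leNgt d0.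
(* B is also specified outside l2: it inverts A - z wherever a solution exists,
   so that B ((A - z) f) = f holds without knowing that A f is in l2 *)
have /choice[B HB] : forall f, exists u, (exists2 v, l2 v & (fun x => nbop v x - z * v x) = f) ->
    l2 u /\ (fun x => nbop u x - z * u x) = f.
  move=> f; have [[v lv ev]|nv] := pselect (exists2 v, l2 v & (fun x => nbop v x - z * v x) = f).
    by exists v.
  by exists (fun=> 0) => /nv.
have Bsolve f : l2 f -> [/\ l2 (B f), forall x, nbop (B f) x - z * B f x = f x &
    forall K, nbound f K -> nbound (B f) (4 / d * K)].
  move=> lf; have [u eu bu] := solve_resolvent d0 dS lf.
  have lu : l2 u := l2_nbound (bu _ (nbound_l2norm lf)).
  have [|lB eB] := HB f; first by exists u.
  have -> : B f = u.
    by apply: inj => // x; rewrite (congr1 (@^~ x) eB) (congr1 (@^~ x) eu).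
  by split=> // x; rewrite -[in RHS]eu.
exists B.
  split.
  - by move=> f /Bsolve[].
  - move=> c f g lf lg; have [lBf ef _] := Bsolve f lf; have [lBg eg _] := Bsolve g lg.
    have [lB e _] := Bsolve _ (l2_lin c lf lg).
    apply: inj => //; first exact: l2_lin.
    by move=> x; rewrite e nbop_lin -ef -eg; ring.
  - exists (Num.sqrt (4 / d)) => f lf; have [lB _ bB] := Bsolve f lf.
    have d4 : 0 <= 4 / d by rewrite divr_ge0 // ltW.
    rewrite -(@ler_pXn2r _ 2) ?nnegrE ?mulr_ge0 ?l2norm_ge0 ?sqrtr_ge0 //.
    rewrite exprMn (sqr_sqrtr d4); apply: l2norm_le; apply: bB; exact: nbound_l2norm.
move=> f lf; split; last by have [_ e _] := Bsolve f lf; apply/funext.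
have [|lB eB] := HB (fun x => nbop f x - z * f x); first by exists f.
by apply: inj => // x; rewrite (congr1 (@^~ x) eB).
Qed.

End Spectral.

(** * Basis functions on the horocycles of a tree *)

Section TreeFunctions.
Variables (R : realType) (q : nat) (T : tree q).
Hypothesis q_gt0 : (0 < q)%N.
Implicit Types (a x y : T) (phi : 'I_q -> R).

Local Notation r := (Num.sqrt (q%:R : R)).

Lemma sqrtq_gt0 : 0 < r.
Proof. by rewrite sqrtr_gt0 ltr0n. Qed.

Lemma sqrtq_sqr : r * r = q%:R.
Proof. by rewrite -expr2 sqr_sqrtr ?ler0n. Qed.

(** The functions f^j_k for all k at once: k is the height of x. *)
Definition treefun a phi x : R :=
  let n := absz (height x - height a) in
  if (height a < height x) && (iter n (@par q T) x == a)
  then phi (lab a (iter n.-1 (@par q T) x)) * r ^- n.-1 else 0.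

Lemma treefun_below a phi x n : iter n.+1 (@par q T) x = a ->
  treefun a phi x = phi (lab a (iter n (@par q T) x)) * r ^- n.
Proof.
move=> xa; have := height_iter n.+1 x; rewrite xa => ha.
have e : absz (height x - height a) = n.+1 by lia.
by rewrite /treefun e /= -iterS xa eqxx andbT; case: ifPn => //; lia.
Qed.

Lemma treefunP a phi x : treefun a phi x = 0 \/ exists n, iter n.+1 (@par q T) x = a.
Proof.
rewrite /treefun; case: ifPn => [/andP[lt /eqP e]|_]; last by left.
by right; exists (absz (height x - height a)).-1; rewrite prednK //; lia.
Qed.

Lemma treefun_depth a phi x : treefun a phi x != 0 ->
  iter (absz (height x - height a)) (@par q T) x = a.
Proof. by rewrite /treefun; case: ifPn => [/andP[_ /eqP->]//|]; rewrite eqxx. Qed.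

Lemma treefun_out a phi x : (forall n, iter n.+1 (@par q T) x <> a) -> treefun a phi x = 0.
Proof. by move=> H; have [//|[n /H]] := treefunP a phi x. Qed.

Lemma treefun_low a phi x : height x <= height a -> treefun a phi x = 0.
Proof. by rewrite /treefun ltNge => ->. Qed.

Lemma treefun_child a phi x l : height a < height x ->
  treefun a phi (child x l) = treefun a phi x / r.
Proof.
move=> ax; have r0 := lt0r_neq0 sqrtq_gt0.
have [[n xa]|nx] := pselect (exists n, iter n.+1 (@par q T) x = a).
  rewrite (treefun_below _ xa) (@treefun_below _ _ _ n.+1); last first.
    by rewrite iterSr par_child.
  by rewrite iterSr par_child -mulrA -invfM -exprSr.
rewrite !treefun_out ?mul0r // => [n e|n]; first by apply: nx; exists n.
rewrite iterSr par_child; case: n => [/= e|n e]; last by apply: nx; exists n.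
by rewrite e ltxx in ax.
Qed.

Lemma treefun_par_iter a phi x n : height a < height (iter n (@par q T) x) ->
  treefun a phi (iter n (@par q T) x) = treefun a phi x * r ^+ n.
Proof.
elim: n => [|n IH] /=; first by rewrite mulr1.
set y := iter n _ x => lt; rewrite exprSr mulrA -IH -/y; last first.
  by move: lt; rewrite height_par; lia.
rewrite -{2}(child_lab y) treefun_child // divfK //.
exact/lt0r_neq0/sqrtq_gt0.
Qed.

Lemma treefun_par a phi x : height a + 1 != height x ->
  treefun a phi (par x) = r * treefun a phi x.
Proof.
move=> ne; have [lt|le] := ltP (height a) (height (par x)).
  by rewrite (@treefun_par_iter a phi x 1) // expr1 mulrC.
rewrite !treefun_low ?mulr0 //.
by move: ne le; rewrite height_par; lia.
Qed.

(** At x = a the right-hand side is zero and the left-hand side is the sum of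
    phi. *)
Lemma sum_treefun_children a phi x : \sum_l phi l = 0 ->
  \sum_l treefun a phi (child x l) = r * treefun a phi x.
Proof.
move=> phi0; have [lt|le] := ltP (height a) (height x).
  under eq_bigr do rewrite treefun_child //.
  rewrite sumr_const card_ord -[LHS]mulr_natr.
  have := sqrtq_sqr; have := lt0r_neq0 sqrtq_gt0; set s := Num.sqrt _ => s0 <-.
  by field.
rewrite (treefun_low _ le) mulr0; have [->|/eqP xa] := eqVneq x a.
  rewrite -[RHS]phi0; apply: eq_bigr => l _.
  rewrite (@treefun_below _ _ _ 0) /=; last by rewrite par_child.
  by rewrite lab_child expr0 invr1 mulr1.
rewrite big1 // => l _; rewrite treefun_out // => n e.
have := height_iter n.+1 (child x l); rewrite e height_child => h.
have n0 : n = 0%N by lia.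
by move: e; rewrite n0 /= par_child.
Qed.

Fixpoint desc a n : seq T :=
  if n is n'.+1 then flatten [seq [seq child x l | l <- enum 'I_q] | x <- desc a n'] else [:: a].

Lemma mem_desc a n x : (x \in desc a n) = (iter n (@par q T) x == a).
Proof.
elim: n x => [|n IH] x; first by rewrite inE.
apply/flattenP/idP => [[s /mapP[y yd ->] /mapP[l _ ->]]|xa].
  by rewrite iterSr par_child -IH.
exists [seq child (par x) l | l <- enum 'I_q].
  by apply: map_f; rewrite IH -iterSr.
by rewrite -{1}(child_lab x); apply: map_f; rewrite mem_enum.
Qed.

Lemma height_desc a n x : x \in desc a n -> height x = height a + n%:Z.
Proof. by rewrite mem_desc => /eqP <-; rewrite height_iter subrK. Qed.

Lemma sum_desc (V : nmodType) (F : T -> V) a n :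
  \sum_(x <- desc a n.+1) F x = \sum_(x <- desc a n) \sum_l F (child x l).
Proof.
rewrite /= big_flatten /= big_map; apply: eq_bigr => x _.
by rewrite big_map big_enum.
Qed.

Lemma sum_treefun_desc a phi n : \sum_l phi l = 0 ->
  \sum_(x <- desc a n) treefun a phi x = 0.
Proof.
move=> phi0; elim: n => [|n IH]; first by rewrite big_seq1 treefun_low.
rewrite sum_desc; under eq_bigr do rewrite sum_treefun_children //.
by rewrite -mulr_sumr IH mulr0.
Qed.

Lemma sum_treefun_sqr a phi phi' n :
  \sum_(x <- desc a n.+1) treefun a phi x * treefun a phi' x = \sum_l phi l * phi' l.
Proof.
elim: n => [|n IH]; rewrite sum_desc.
  rewrite big_seq1; apply: eq_bigr => l _.
  rewrite !(@treefun_below _ _ _ 0) /= ?par_child //.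
  by rewrite lab_child expr0 invr1 !mulr1.
rewrite -IH big_seq [RHS]big_seq; apply: eq_bigr => x /height_desc hx.
under eq_bigr do rewrite !treefun_child ?hx ?ltrDl //.
rewrite sumr_const card_ord -[LHS]mulr_natr.
have := sqrtq_sqr; have := lt0r_neq0 sqrtq_gt0; set s := Num.sqrt _ => s0 <-.
by field.
Qed.

(** Below a, the function of the higher apex a' only depends on the height. *)
Lemma orthogonal_treefun_above a a' phi phi' n : \sum_l phi l = 0 ->
  height a' < height a ->
  \sum_(x <- desc a n) treefun a phi x * treefun a' phi' x = 0.
Proof.
move=> phi0 lt; rewrite big_seq.
rewrite (eq_bigr (fun x => treefun a phi x * (treefun a' phi' a / r ^+ n))).
  by rewrite -big_seq -mulr_suml sum_treefun_desc // mul0r.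
move=> x; rewrite mem_desc => /eqP xa; congr (_ * _).
rewrite -{1}xa treefun_par_iter ?xa // mulfK //.
by rewrite expf_neq0 //; exact/lt0r_neq0/sqrtq_gt0.
Qed.

Lemma desc_uniq a n : uniq (desc a n).
Proof.
elim: n => [//|n /=]; elim: (desc a n) => //= x s IH /andP[xs us].
rewrite cat_uniq map_inj_uniq ?enum_uniq //=; last exact: child_inj.
rewrite IH // andbT; apply/hasPn => y /flattenP[_ /mapP[z zs ->] /mapP[l _ ->]].
apply/negP => /mapP[l' _ /(congr1 (@par q T))]; rewrite !par_child => e.
by move: xs; rewrite -e zs.
Qed.

(** Of two distinct apices of the same height, the supports are disjoint;
    otherwise the function of the higher apex is constant where the other one,
    of sum zero, lives. *)
Lemma orthogonal_treefun a a' phi phi' n : \sum_l phi l = 0 -> \sum_l phi' l = 0 ->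
  a <> a' -> \sum_(x <- desc a n) treefun a phi x * treefun a' phi' x = 0.
Proof.
move=> phi0 phi'0 aa'; have [lt|] := ltP (height a') (height a).
  exact: orthogonal_treefun_above.
rewrite le_eqVlt => /predU1P[e|lt].
  rewrite big_seq big1 // => x; rewrite mem_desc => /eqP xa.
  rewrite (@treefun_out a') ?mulr0 // => m xa'.
  have h := height_iter n x; have h' := height_iter m.+1 x.
  rewrite xa in h; rewrite xa' in h'; have em : n = m.+1 by lia.
  by apply: aa'; rewrite -xa -xa' em.
have [lt'|le] := ltP (height a') (height a + n%:Z); last first.
  by rewrite big_seq big1 // => x /height_desc hx; rewrite (@treefun_low a') ?mulr0 ?hx.
pose m := absz (height a + n%:Z - height a')%R.
have hm : height a' + m%:Z = height a + n%:Z by lia.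
pose F x := if height x == height a + n%:Z then treefun a' phi' x * treefun a phi x else 0.
rewrite (eq_big_seq F); last by move=> x /height_desc hx; rewrite /F hx eqxx mulrC.
rewrite (@big_same_support _ _ _ (desc a' m) _ (desc_uniq _ _) (desc_uniq _ _)).
- rewrite (eq_big_seq (fun x => treefun a' phi' x * treefun a phi x)); last first.
    by move=> x /height_desc hx; rewrite /F hx hm eqxx.
  exact: orthogonal_treefun_above.
- move=> x; rewrite mem_desc /F; case: ifPn => // /eqP hx.
  have [->|/treefun_depth] := eqVneq (treefun a phi x) 0; first by rewrite mulr0.
  rewrite hx (_ : absz _ = n) => [->|]; first by rewrite eqxx.
  by lia.
move=> x; rewrite mem_desc /F; case: ifPn => // /eqP hx.
have [->|/treefun_depth] := eqVneq (treefun a' phi' x) 0; first by rewrite mul0r.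
rewrite hx -hm (_ : absz _ = m) => [->|]; first by rewrite eqxx.
by lia.
Qed.

Lemma sqrt_powR n : (q%:R : R) `^ ((- n%:Z)%:~R / 2) = r ^- n.
Proof.
rewrite mulrC powRrM powR12_sqrt ?ler0n // rmorphN /= powRN -pmulrn powR_mulrn //.
Qed.

(** The normalised indicator of the points of the horocycle of x0 with the same
    M-th predecessor as x0. *)
Definition horo_avg (x0 : T) M (x : T) : R :=
  if (height x == height x0) && (iter M (@par q T) x == iter M (@par q T) x0)
  then q%:R ^- M else 0.

Lemma horo_avg0 x0 x : horo_avg x0 0 x = (x == x0)%:R.
Proof.
by rewrite /horo_avg /= expr0 invr1; case: (x =P x0) => [->|_]; rewrite ?eqxx ?andbF.
Qed.

(** Two consecutive averages differ by a multiple of the function attached to the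
    vertex p^(M+1) x0 and to the function 1_l - 1/q, which has sum zero. *)
Lemma horo_avg_sub x0 M x : horo_avg x0 M x - horo_avg x0 M.+1 x =
  r ^+ M * q%:R ^- M *
  (if height x == height x0 then treefun (iter M.+1 (@par q T) x0)
     (fun l => (l == lab (iter M.+1 (@par q T) x0) (iter M (@par q T) x0))%:R - q%:R^-1) x else 0).
Proof.
rewrite /horo_avg; case: (eqVneq (height x)) => [hx|]; last by rewrite subrr mulr0.
have r0 := lt0r_neq0 sqrtq_gt0; rewrite [_ && _]/= [X in _ - X]/=.
case: (eqVneq (par (iter M (@par q T) x))) => [e|ne] /=.
  rewrite (@treefun_below _ _ _ M e).
  have -> : (lab (par (iter M (@par q T) x0)) (iter M (@par q T) x) ==
      lab (par (iter M (@par q T) x0)) (iter M (@par q T) x0)) =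
      (iter M (@par q T) x == iter M (@par q T) x0).
    apply/eqP/eqP => [el|->//].
    by rewrite -(child_lab (iter M (@par q T) x)) e el child_lab.
  have rM : r ^+ M != 0 by rewrite expf_neq0.
  rewrite [RHS]mulrA [RHS]mulrC !mulrA mulVf // mul1r mulrBr exprS invfM.
  by case: eqP => _; rewrite ?mulr1 ?mulr0 [q%:R^-1 * _]mulrC.
rewrite ifN; last by apply: contra ne => /eqP ->.
rewrite subrr treefun_out ?mulr0 // => n e.
have h := height_iter n.+1 x; rewrite e height_par height_iter hx in h.
have en : n = M by lia.
by rewrite -e en eqxx in ne.
Qed.

Lemma sum_horo_avg_sqr x0 M :
  \sum_(x <- desc (iter M (@par q T) x0) M) horo_avg x0 M x ^+ 2 = q%:R ^- M.
Proof.
have sz a n : size (desc a n) = (q ^ n)%N.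
  elim: n => //= n IHn; rewrite expnS -IHn; elim: (desc a n) => [|x s IH] /=; first by rewrite muln0.
  by rewrite size_cat IH size_map size_enum_ord mulnS.
rewrite (eq_big_seq (fun=> q%:R ^- M ^+ 2)) => [|x xd].
  rewrite big_const_seq count_predT sz iter_addr_0 -[LHS]mulr_natr natrX.
  by rewrite expr2 divfK // expf_neq0 // pnatr_eq0 -lt0n.
rewrite /horo_avg -mem_desc xd (height_desc xd) height_iter subrK eqxx //.
Qed.

Lemma horo_avg_supp x0 M x : x \notin desc (iter M (@par q T) x0) M -> horo_avg x0 M x = 0.
Proof. by rewrite mem_desc /horo_avg => /negbTE ->; rewrite andbF. Qed.

End TreeFunctions.

Section EdgeFunctions.
Variables (R : realType) (n : nat).

Local Notation phi l := (@phil R n l).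

(** phil takes one positive value, then n - l equal negative ones. *)
Lemma sum_phil_fun (G : R -> R) l : G 0 = 0 -> (1 <= l <= n - 1)%N ->
  \sum_s G (phi l s) = G ((n - l)%:R / Num.sqrt ((n - l) * (n + 1 - l))%:R) +
    (n - l)%:R * G (- (1 / Num.sqrt ((n - l) * (n + 1 - l))%:R)).
Proof.
move=> G0 ln; pose F (s : nat) : R := if (s < l.-1)%N then 0
  else if s == l.-1 then (n - l)%:R / Num.sqrt ((n - l) * (n + 1 - l))%:R
  else - (1 / Num.sqrt ((n - l) * (n + 1 - l))%:R).
rewrite (_ : \sum_s _ = \sum_(0 <= s < n) G (F s)); last by rewrite big_mkord.
rewrite (@big_cat_nat _ _ _ l.-1) //=; last by lia.
rewrite big_nat_cond big1 ?add0r; last first.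
  by move=> s /andP[/andP[_ lt] _]; rewrite /F lt.
rewrite big_ltn; last by lia.
rewrite {1}/F ltnn eqxx; congr (_ + _).
rewrite (eq_big_nat _ _ (F2 := fun=> G (- (1 / Num.sqrt ((n - l) * (n + 1 - l))%:R)))).
  by rewrite sumr_const_nat -[LHS]mulr_natl; congr (_%:R * _); lia.
move=> s /andP[ls _]; rewrite /F ifN; last by lia.
by rewrite ifN //; apply/eqP; lia.
Qed.

Lemma phil_norm_gt0 l : (1 <= l <= n - 1)%N ->
  0 < Num.sqrt ((n - l) * (n + 1 - l))%:R :> R.
Proof. by move=> ln; rewrite sqrtr_gt0 ltr0n muln_gt0; apply/andP; lia. Qed.

Lemma sum_phil l : (1 <= l <= n - 1)%N -> \sum_s phi l s = 0.
Proof.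
move=> ln; rewrite (sum_phil_fun (G := id)) //.
by rewrite mulrN mulrA mulr1 subrr.
Qed.

Lemma sum_phil_sqr l : (1 <= l <= n - 1)%N -> \sum_s phi l s * phi l s = 1.
Proof.
move=> ln; rewrite (sum_phil_fun (G := fun t => t * t)) ?mulr0 //.
have := phil_norm_gt0 ln; set N := Num.sqrt _ => N0.
have : N * N = (n - l)%:R * ((n - l)%:R + 1).
  rewrite -expr2 sqr_sqrtr ?ler0n //; have -> : (n + 1 - l = (n - l).+1)%N by lia.
  by rewrite natrM -natr1.
move: N0 (n - l)%:R => N0 m e.
have Nn : N != 0 by rewrite gt_eqF.
apply: (mulIf (mulf_neq0 Nn Nn)); rewrite mul1r {2}e.
by field.
Qed.

Lemma sum_phil_lt l l' : (l < l')%N -> (1 <= l <= n - 1)%N -> (1 <= l' <= n - 1)%N ->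
  \sum_s phi l s * phi l' s = 0.
Proof.
move=> ll ln ln'.
rewrite (eq_bigr (fun s => - (1 / Num.sqrt ((n - l) * (n + 1 - l))%:R) * phi l' s)).
  by rewrite -mulr_sumr sum_phil // mulr0.
move=> s _; rewrite /phil; case: (ltnP s l'.-1) => ls'; first by rewrite !mulr0.
rewrite ifN; last by lia.
by rewrite ifN //; apply/eqP; lia.
Qed.

Lemma sum_philM l l' : (1 <= l <= n - 1)%N -> (1 <= l' <= n - 1)%N ->
  \sum_s phi l s * phi l' s = (l == l')%:R.
Proof.
move=> ln ln'; case: (ltngtP l l') => [lt|lt|<-]; first exact: sum_phil_lt.
  by under eq_bigr do rewrite mulrC; exact: sum_phil_lt.
exact: sum_phil_sqr.
Qed.

(** The functions phil span the functions of sum zero: the first value of a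
    function of sum zero is cancelled by a multiple of one of them. *)
Lemma phil_span (W : ('I_n -> R) -> Prop) :
  W (fun=> 0) -> (forall c f g, W f -> W g -> W (fun s => c * f s + g s)) ->
  (forall l, (1 <= l <= n - 1)%N -> W (phi l)) ->
  forall f, \sum_s f s = 0 -> W f.
Proof.
move=> W0 Wlin Wphi.
suff H m f : (forall s : 'I_n, (s < n - m)%N -> f s = 0) -> \sum_s f s = 0 -> W f.
  by move=> f; apply: (H n) => s; rewrite subnn.
elim: m f => [|m IH] f f0 sf.
  by rewrite (_ : f = fun=> 0) //; apply/funext => s; apply: f0; rewrite subn0.
have [nm|mn] := leqP n m; first by apply: IH sf => s ls; apply: f0; lia.
have tn : (n - m.+1 < n)%N by lia.
pose t := Ordinal tn; case: m => [|m] in IH f0 mn tn t *.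
  suff -> : f = fun=> 0 by [].
  have f0' s : s != t -> f s = 0.
    by move=> st; apply: f0; have := ltn_ord s; move: st; rewrite -val_eqE /= => /eqP; lia.
  apply/funext => s; have [->|/f0' //] := eqVneq s t.
  by move: sf; rewrite (bigD1 t) //= big1 ?addr0.
pose l := t.+1; have ln : (1 <= l <= n - 1)%N by rewrite /l /=; lia.
have pt : phi l t = (n - l)%:R / Num.sqrt ((n - l) * (n + 1 - l))%:R.
  by rewrite /phil /= ltnn eqxx.
have pt0 : phi l t != 0.
  rewrite pt mulf_neq0 ?invr_eq0 ?pnatr_eq0 ?gt_eqF ?phil_norm_gt0 //; lia.
pose c := f t / phi l t; pose f' s := f s - c * phi l s.
have -> : f = fun s => c * phi l s + f' s.
  by apply/funext => s; rewrite /f' addrC subrK.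
apply: Wlin; first exact: Wphi.
apply: IH => [s ls|]; last by rewrite sumrB sf -mulr_sumr sum_phil // mulr0 subr0.
rewrite /f'; have [->|st] := eqVneq s t; first by rewrite /c divfK // subrr.
have lt : (s < t)%N by move: st; rewrite -val_eqE /= => /eqP; lia.
by rewrite f0 // {1}/phil /= lt mulr0 subr0.
Qed.

End EdgeFunctions.

Section HoroDensity.
Variables (R : realType) (q : nat) (T : tree q).
Hypothesis q_gt0 : (0 < q)%N.

Definition horofun (k : int) (a : T) (phi : 'I_q -> R) (x : T) : R :=
  if height x == k then treefun a phi x else 0.

(** On a horocycle, the indicator of a point differs from a small multiple of
    the indicator of a large finite set by a combination of basis functions. *)
Lemma point_decomposition (W : (T -> R) -> Prop) (x0 : T) :
  W (fun=> 0) -> (forall c f g, W f -> W g -> W (fun x => c * f x + g x)) ->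
  (forall a l, height a < height x0 -> (1 <= l <= q - 1)%N ->
     W (horofun (height x0) a (@phil R q l))) ->
  forall M, W (fun x => (x == x0)%:R - @horo_avg R q T x0 M x).
Proof.
move=> W0 Wlin Wb; elim=> [|M IH].
  rewrite (_ : (fun x => _) = fun=> 0) //.
  by apply/funext => x; rewrite horo_avg0 subrr.
pose a := iter M.+1 (@par q T) x0.
have ha : height a < height x0 by rewrite height_iter; lia.
pose f l := (l == lab a (iter M (@par q T) x0))%:R - q%:R^-1 : R.
have Wf : W (horofun (height x0) a f).
  apply: (phil_span (W := fun f => W (horofun (height x0) a f))).
  - rewrite (_ : horofun _ _ _ = fun=> 0) //; apply/funext => x; rewrite /horofun.
    by case: ifP => // _; rewrite /treefun; case: ifP; rewrite ?mul0r.
  - move=> c g h Wg Wh; have := Wlin c _ _ Wg Wh; congr W.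
    apply/funext => x; rewrite /horofun; case: ifP => // _; last by rewrite mulr0 addr0.
    by rewrite /treefun; case: ifP => _; rewrite ?mulr0 ?addr0 // mulrDl mulrA.
  - by move=> l ln; apply: Wb.
  rewrite sumrB sumr_const card_ord -[_ *+ q]mulr_natr mulVf ?pnatr_eq0 -?lt0n //.
  rewrite (bigD1 (lab a (iter M (@par q T) x0))) //= eqxx big1 ?addr0 ?subrr //.
  by move=> l /negbTE ->.
have := Wlin (Num.sqrt (q%:R : R) ^+ M * q%:R ^- M) _ _ Wf IH; congr W.
apply/funext => x; rewrite /horofun -horo_avg_sub //.
by rewrite addrC -addrA; congr (_ + _); rewrite addrA addNr add0r.
Qed.

End HoroDensity.

Section FtreeE.
Variables (R : realType) (d : nat) (q : 'I_d -> nat) (T : forall j, tree (q j)).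
Variables (j : 'I_d) (phi : 'I_(q j) -> R).
Hypothesis qj0 : (0 < q j)%N.

Lemma ftreeE (a : T j) k x : ftree a (fun s => (phi s)%:C) k x =
  if height x == k then (treefun a phi x)%:C else 0.
Proof.
rewrite /ftree; case: pickP => [l /asboolP[ak xk [v [/is_succP va vl /ancestorP[n vx]]]]|no].
  have xa : iter n.+1 (@par _ (T j)) x = a by rewrite /= -vx.
  have := height_iter n.+1 x; rewrite xa => h.
  rewrite xk eqxx (treefun_below qj0 _ xa) -vx vl -sqrt_powR (_ : height a - k + 1 = - n%:Z).
    by rewrite rmorphM.
  by rewrite -xk; lia.
case: eqP => // xk; have [->//|[n xa]] := treefunP qj0 a phi x.
have := height_iter n.+1 x; rewrite xa => h.
have := no (lab a (iter n (@par _ (T j)) x)); rewrite asboolT //; split=> //.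
  by rewrite -xk; lia.
exists (iter n (@par _ (T j)) x); split=> //; first by apply/is_succP.
by apply/ancestorP; exists n.
Qed.

End FtreeE.

(** * The horocyclic product *)

Section DLGraph.
Variables (d : nat) (q : 'I_d -> nat) (T : forall j, tree (q j)).
Implicit Types (x y : DL T).

Lemma dl_height x : \sum_j height (dlcoord x j) = 0.
Proof. exact/eqP/(svalP x). Qed.

Lemma dl_ext x y : (forall j, dlcoord x j = dlcoord y j) -> x = y.
Proof. by move=> e; apply: val_inj; apply/ffunP. Qed.

(** The point x is the default value when the heights of the coordinates do not
    add up to zero. *)
Definition dl_point x (y : forall j, T j) : DL T := insubd x (finfun y : {dffun forall j, T j}).

Lemma dl_pointE x (y : forall j, T j) j : \sum_i height (y i) = 0 -> dlcoord (dl_point x y) j = y j.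
Proof.
move=> y0; rewrite /dlcoord /dl_point -[sval _]/(val _) insubdK ?ffunE //.
by apply/eqP; rewrite -[RHS]y0; apply: eq_bigr => k _; rewrite ffunE.
Qed.

(** The neighbour of x obtained by going up to the successor with label l in T_i
    and down in T_j. It is locked because comparing two moves by conversion would
    unfold the dependent updates. *)
Fact dl_move_key : unit. Proof. exact: tt. Qed.

Definition dl_move x (i j : 'I_d) : 'I_(q i) -> DL T := locked_with dl_move_key (fun l =>
  dl_point x (dfwith (dfwith (dlcoord x) i (child (dlcoord x i) l)) j (par (dlcoord x j)))).

Lemma sum_two_changes (i j : 'I_d) (f g : 'I_d -> int) : i != j ->
  (forall k, k != i -> k != j -> f k = g k) ->
  \sum_k f k = \sum_k g k + (f i - g i) + (f j - g j).
Proof.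
move=> ij fg; have ji : j != i by rewrite eq_sym.
rewrite (bigD1 i) // (bigD1 j) //= [in RHS](bigD1 i) // [in RHS](bigD1 j) //=.
rewrite [X in _ + (_ + X) = _](eq_bigr g) => [|k /andP[ki kj]]; last exact: fg.
by lia.
Qed.

Section Move.
Variables (x : DL T) (i j : 'I_d) (l : 'I_(q i)).
Hypothesis ij : i != j.

Let z := dfwith (dfwith (dlcoord x) i (child (dlcoord x i) l)) j (par (dlcoord x j)).

Let zi : z i = child (dlcoord x i) l.
Proof. by rewrite /z dfwithout 1?eq_sym // dfwithin. Qed.

Let zj : z j = par (dlcoord x j).
Proof. by rewrite /z dfwithin. Qed.

Let zk k : k != i -> k != j -> z k = dlcoord x k.
Proof. by move=> ki kj; rewrite /z !dfwithout // eq_sym. Qed.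

Let z0 : \sum_k height (z k) = 0.
Proof.
rewrite (@sum_two_changes i j _ (fun k => height (dlcoord x k)) ij) ?dl_height.
  by rewrite zi zj height_child height_par; lia.
by move=> k ki kj; rewrite zk.
Qed.

Lemma dl_move_up : dlcoord (dl_move x j l) i = child (dlcoord x i) l.
Proof. by rewrite /dl_move unlock dl_pointE. Qed.

Lemma dl_move_down : dlcoord (dl_move x j l) j = par (dlcoord x j).
Proof. by rewrite /dl_move unlock dl_pointE. Qed.

Lemma dl_move_other k : k != i -> k != j -> dlcoord (dl_move x j l) k = dlcoord x k.
Proof. by move=> ki kj; rewrite /dl_move unlock dl_pointE //; apply: zk. Qed.

Lemma height_dl_move k : height (dlcoord (dl_move x j l) k) =
  height (dlcoord x k) + (k == i)%:R - (k == j)%:R.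
Proof.
have [->|ki] := eqVneq k i; first by rewrite dl_move_up height_child (negbTE ij) subr0.
have [->|kj] := eqVneq k j; first by rewrite dl_move_down height_par addr0.
by rewrite dl_move_other // addr0 subr0.
Qed.

End Move.

Lemma dl_move_inj x i j i' j' (l : 'I_(q i)) (l' : 'I_(q i')) : i != j -> i' != j' ->
  dl_move x j l = dl_move x j' l' -> i = i' /\ j = j'.
Proof.
move=> ij ij' e; have hi k : (k == i)%:R - (k == j)%:R = (k == i')%:R - (k == j')%:R :> int.
  have ek := congr1 (fun y : DL T => height (dlcoord y k)) e.
  have := etrans (esym (height_dl_move x l ij k)) (etrans ek (height_dl_move x l' ij' k)).
  by lia.
split.
  have := hi i; rewrite eqxx (negbTE ij).
  by have [//|_] := eqVneq i i'; case: (i == j').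
have := hi j; rewrite eqxx eq_sym (negbTE ij).
by have [//|_] := eqVneq j j'; case: (j == i').
Qed.

Definition dl_moves := {i : 'I_d & ('I_d * 'I_(q i))%type}.

Definition dl_nb x : seq (DL T) :=
  [seq dl_move x (tagged t).1 (tagged t).2 | t : dl_moves <- enum {: dl_moves} & tag t != (tagged t).1].

Lemma sum_dl_nb (V : nmodType) (F : DL T -> V) x :
  \sum_(y <- dl_nb x) F y = \sum_i \sum_(j | j != i) \sum_l F (dl_move (i := i) x j l).
Proof.
rewrite big_map big_filter big_enum_cond /=.
rewrite (eq_bigr (fun i => \sum_(p : 'I_d * 'I_(q i) | i != p.1) F (dl_move x p.1 p.2))).
  by rewrite sig_big_dep; apply: eq_big => [[i [j l]]|[i [j l]]].
move=> i _; rewrite pair_big_dep /=; apply: eq_bigl => -[j l] /=.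
by rewrite andbT eq_sym.
Qed.

Lemma dl_nb_uniq x : uniq (dl_nb x).
Proof.
rewrite map_inj_in_uniq; first by rewrite filter_uniq // enum_uniq.
move=> -[i [j l]] [i' [j' l']].
rewrite !mem_filter /= => /andP[ij _] /andP[ij' _] e.
have [ei ej] := dl_move_inj ij ij' e.
case: i' / ei in l' ij' e *; case: j' / ej in ij' e *.
have eii := congr1 (fun y : DL T => dlcoord y i) e.
have ell := etrans (esym (dl_move_up x l ij)) (etrans eii (dl_move_up x l' ij)).
by rewrite (child_inj ell).
Qed.

Lemma mem_dl_nb x y : y \in dl_nb x <-> dl_adj x y.
Proof.
split=> [/mapP[[i [j l]]]|[i [j [ij xi xj xk]]]].
  rewrite mem_filter /= => /andP[ij _] ->; exists i, j; split=> //.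
  - by rewrite dl_move_up // edge_par par_child eqxx orbT.
  - by rewrite dl_move_down // edge_par eqxx.
  - by move=> k ki kj; rewrite dl_move_other.
have up i' j' : i' != j' -> par (dlcoord y i') = dlcoord x i' -> par (dlcoord x j') = dlcoord y j' ->
    (forall k, k != i' -> k != j' -> dlcoord x k = dlcoord y k) -> y \in dl_nb x.
  move=> ij' yi yj yk; apply/mapP.
  exists (Tagged (fun i => ('I_d * 'I_(q i))%type) (j', lab (dlcoord x i') (dlcoord y i'))).
    by rewrite mem_filter /= ij' mem_enum.
  apply: dl_ext => k /=; have [->|ki] := eqVneq k i'.
    by rewrite dl_move_up // -yi child_lab.
  have [->|kj] := eqVneq k j'; first by rewrite dl_move_down.
  by rewrite dl_move_other // yk.
have := @sum_two_changes i j (fun k => height (dlcoord x k)) (fun k => height (dlcoord y k)) ij.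
rewrite !dl_height => /(_ (fun k ki kj => congr1 _ (xk k ki kj))).
move: xi xj; rewrite !edge_par => /orP[/eqP yi|/eqP yi] /orP[/eqP yj|/eqP yj].
- by rewrite yi yj !height_par; lia.
- by move=> _; apply: (up j i); rewrite 1?eq_sym // => k kj ki; apply: xk.
- by move=> _; apply: (up i j).
- by rewrite yi yj !height_par; lia.
Qed.

Lemma dl_adj_sym x y : dl_adj x y -> dl_adj y x.
Proof.
move=> [i [j [ij xi xj xk]]]; exists i, j; split=> //.
- by rewrite edge_par orbC -edge_par.
- by rewrite edge_par orbC -edge_par.
- by move=> k ki kj; rewrite xk.
Qed.

Lemma dl_nb_sym x y : (y \in dl_nb x) = (x \in dl_nb y).
Proof. by apply/idP/idP => /mem_dl_nb/dl_adj_sym/mem_dl_nb. Qed.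

Lemma srw_nbop (R : realType) : srw T R = nbop ((dl_deg q)%:R^-1 : R[i]) dl_nb.
Proof.
apply/funext => f; apply/funext => x; rewrite /srw /nbop.
rewrite (_ : [set y | dl_adj x y] = [set` dl_nb x]) -?fsbig_seq ?dl_nb_uniq //.
by apply/seteqP; split=> y /mem_dl_nb.
Qed.

End DLGraph.

Section DLProducts.
Variables (d : nat) (q : 'I_d -> nat) (T : forall j, tree (q j)).
Variable L : forall j, seq (T j).

Let n := \max_j size (L j).

Let point (f : {ffun 'I_d -> 'I_n}) : {dffun forall j, T j} :=
  finfun (fun j => nth (origin (T j)) (L j) (f j)).

Let ranks : pred {ffun 'I_d -> 'I_n} :=
  [pred f in family (fun j => [pred i : 'I_n | i < size (L j)]%N)].

(** Coordinates are chosen by their ranks in the lists, that is by a function from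
    'I_d to a common 'I_n, so that distributivity applies to sums. *)
Definition dl_prod : seq (DL T) := pmap insub [seq point f | f <- enum ranks].

Lemma size_le j : (size (L j) <= n)%N.
Proof. by rewrite /n (bigD1 j) //= leq_maxl. Qed.

Lemma mem_dl_prod x : x \in dl_prod <-> forall j, dlcoord x j \in L j.
Proof.
rewrite mem_pmap_sub; split=> [/mapP[f]|xL].
  rewrite mem_enum => /familyP fr xf j; rewrite /dlcoord -[sval x]/(val x) xf ffunE.
  exact/mem_nth/fr.
have lt j : (index (dlcoord x j) (L j) < n)%N.
  by apply: leq_trans (size_le j); rewrite index_mem; exact: xL.
apply/mapP; exists [ffun j => Ordinal (lt j)].
  by rewrite mem_enum; apply/familyP => j; rewrite ffunE inE /= index_mem; exact: xL.
apply/ffunP => j; by rewrite !ffunE /= nth_index //; exact: xL.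
Qed.

Hypothesis Luniq : forall j, uniq (L j).

Let point_inj : {in ranks &, injective point}.
Proof.
move=> f g /familyP fr /familyP gr e; apply/ffunP => j; apply/val_inj => /=.
have := congr1 (fun h : {dffun forall j, T j} => h j) e; rewrite !ffunE => /eqP.
by rewrite nth_uniq ?Luniq //; [move/eqP | exact: fr | exact: gr].
Qed.

Lemma dl_prod_uniq : uniq dl_prod.
Proof.
apply: pmap_sub_uniq; rewrite map_inj_in_uniq ?enum_uniq // => f g.
by rewrite !mem_enum; apply: point_inj.
Qed.

(** Distributivity: as the heights of the horocycles add up to zero, every choice
    of coordinates in the lists is a point of the horocyclic product. *)
Lemma sum_dl_prod (V : comPzSemiRingType) (F : forall j, T j -> V) (kappa : 'I_d -> int) :
  \sum_j kappa j = 0 -> (forall j y, y \in L j -> height y = kappa j) ->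
  \sum_(x <- dl_prod) \prod_j F j (dlcoord x j) = \prod_j \sum_(y <- L j) F j y.
Proof.
move=> k0 Lk.
pose G (x : {dffun forall j, T j}) := \prod_j F j (x j).
rewrite (eq_bigr (fun x => G (val x))) // -(big_map val xpredT G).
have -> : [seq val x | x <- dl_prod] = [seq point f | f <- enum ranks].
  rewrite /dl_prod pmap_filter; last exact: insubK.
  apply/all_filterP/allP => y /mapP[f]; rewrite mem_enum => /familyP fr ->.
  rewrite isSome_insub -[X in _ == X]k0; apply/eqP; apply: eq_bigr => j _.
  by rewrite ffunE (Lk j) //; apply/mem_nth/fr.
rewrite big_map big_enum /=.
under [RHS]eq_bigr => j _ do rewrite (big_nth (origin (T j))) big_mkord
  (big_ord_widen _ (fun i => F j (nth (origin (T j)) (L j) i)) (size_le j)).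
rewrite bigA_distr_big_dep /=; apply: eq_bigr => f _.
by apply: eq_bigr => j _; rewrite ffunE.
Qed.

End DLProducts.

(** * The simplex of height vectors *)

Section SimplexPoints.
Variable d : nat.
Implicit Types k : 'rV[int]_d.

(** The coordinates of k measured from the lower bounds defining B_N. *)
Definition depth (N : nat) k (j : 'I_d) : int := k 0 j + (lastc j)%:R *+ N.

Lemma inBoP N k : inBo N k <-> inA k /\ forall j, 0 < depth N k j.
Proof.
split=> [/andP[kA /forallP kj]|[kA kj]]; first split=> // j.
  by have := kj j; rewrite /depth; case: (lastc j); rewrite ?mul0rn; lia.
rewrite /inBo kA; apply/forallP => j; have := kj j; rewrite /depth.
by case: (lastc j); rewrite ?mul0rn; lia.
Qed.

Lemma inBP N k : inB N k <-> inA k /\ forall j, 0 <= depth N k j.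
Proof.
split=> [/andP[kA /forallP kj]|[kA kj]]; first split=> // j.
  by have := kj j; rewrite /depth; case: (lastc j); rewrite ?mul0rn; lia.
rewrite /inB kA; apply/forallP => j; have := kj j; rewrite /depth.
by case: (lastc j); rewrite ?mul0rn; lia.
Qed.

Lemma inBo_inB N k : inBo N k -> inB N k.
Proof. by move=> /inBoP[kA kj]; apply/inBP; split=> // j; apply/ltW. Qed.

Lemma V0_Bo (R : realType) N (u : 'rV[int]_d -> R[i]) k : V0 N u -> ~~ inBo N k -> u k = 0.
Proof.
move=> [uB ubd] ko; have [kB|/uB //] := boolP (inB N k).
by apply: ubd; rewrite /inbd kB.
Qed.

Hypothesis d_gt0 : (0 < d)%N.

Lemma sum_lastc : \sum_(j < d) (lastc j)%:R = 1 :> int.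
Proof.
case: d d_gt0 => // n _; rewrite (bigD1 ord_max) //= /lastc eqxx big1 ?addr0 // => j.
by rewrite -val_eqE /= eqSS => /negbTE ->.
Qed.

Lemma sum_depth N k : inA k -> \sum_j depth N k j = N%:Z.
Proof.
move=> /eqP k0; rewrite big_split /= k0 add0r sumrMnl sum_lastc.
exact: natz.
Qed.

Lemma finite_inB N : finite_set [set k : 'rV[int]_d | inB N k].
Proof.
pose f (g : {ffun 'I_d -> 'I_N.+1}) : 'rV[int]_d := \row_j ((g j)%:Z - (lastc j)%:R *+ N).
apply: (@sub_finite_set _ _ (f @` setT)); last exact/finite_image/finite_finset.
move=> k /inBP[kA kj].
have le j : (absz (depth N k j) < N.+1)%N.
  have := sum_depth N kA; rewrite (bigD1 j) //=; set s := \sum_(_ | _) _ => e.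
  have s0 : 0 <= s by apply: sumr_ge0 => i _; apply: kj.
  by have := kj j; lia.
exists [ffun j => Ordinal (le j)] => //; apply/rowP => j; rewrite !mxE ffunE /=.
by rewrite gez0_abs ?kj // /depth addrK.
Qed.

Lemma finite_inBo N : finite_set [set k : 'rV[int]_d | inBo N k].
Proof. by apply: sub_finite_set (finite_inB N) => k /inBo_inB. Qed.

Definition Bo_seq N : seq 'rV[int]_d := finmap.enum_fset (fset_set [set k | inBo N k]).

Lemma Bo_seq_uniq N : uniq (Bo_seq N).
Proof. exact: finmap.fset_uniq. Qed.

Lemma mem_Bo_seq N k : (k \in Bo_seq N) = inBo N k.
Proof. by rewrite /Bo_seq in_fset_set ?mem_setE //; exact: finite_inBo. Qed.

Lemma V0inner_Bo (R : realType) N (u v : 'rV[int]_d -> R[i]) : V0 N u ->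
  V0inner N u v = \sum_(k <- Bo_seq N) u k * (v k)^*.
Proof.
move=> uV; rewrite /V0inner (fsbig_seq _ _ (Bo_seq_uniq N)).
apply/esym/fsbig_widen => k /=; first by rewrite mem_Bo_seq => /inBo_inB.
by move=> [_ /negP]; rewrite mem_Bo_seq => /(V0_Bo uV) ->; rewrite mul0r.
Qed.

End SimplexPoints.

Lemma conjM_real (R : realType) (z : R[i]) (r : R) :
  ((z * r%:C)^*)%R = (z^*)%R * r%:C.
Proof.
case: z => a b; apply/eqP; rewrite eq_complex /=.
by apply/andP; split; apply/eqP; ring.
Qed.

Lemma uniq_flatten_map (I J : eqType) (s : seq I) (F : I -> seq J) (h : J -> I) :
  uniq s -> (forall i, i \in s -> uniq (F i)) ->
  (forall i y, i \in s -> y \in F i -> h y = i) -> uniq (flatten [seq F i | i <- s]).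
Proof.
elim: s => //= i s IH /andP[is_ us] uF hF.
rewrite cat_uniq uF ?mem_head // IH // => [|j js|j y js yj]; first last.
- by apply: hF yj; rewrite inE js orbT.
- by apply: uF; rewrite inE js orbT.
rewrite andbT; apply/hasPn => y /flattenP[_ /mapP[j js ->] yj].
apply/negP => yi; have := hF i y (mem_head _ _) yi.
by rewrite (hF j y) ?inE ?js ?orbT // => e; rewrite -e js in is_.
Qed.

Lemma fsbig_single (V : nmodType) (I : choiceType) (A : set I) (i0 : I) (F : I -> V) :
  (forall i, i <> i0 -> F i = 0) ->
  \sum_(i \in A) F i = if i0 \in A then F i0 else 0.
Proof.
move=> F0; case: ifPn => [/set_mem Ai|nA].
  rewrite -(@fsbig_set1 V 0 +%R I i0 F); apply/esym/fsbig_widen => [i -> //|i [_ ne]].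
  exact: F0.
rewrite fsbig1 // => i Ai; apply: F0 => e; case/negP: nA.
by rewrite -e; apply/mem_set.
Qed.

(** * Functions attached to a polyhedron *)

Section PolyhedronFunctions.
Variables (R : realType) (d : nat) (q : 'I_d -> nat) (T : forall j, tree (q j)).
Local Notation C := R[i].
Hypothesis d_gt0 : (0 < d)%N.
Hypothesis q_gt0 : forall j, (0 < q j)%N.
Implicit Types (a : forall j, T j) (x : DL T) (phi : forall j, 'I_(q j) -> R).

Definition treeprod a phi x : R := \prod_j treefun (a j) (phi j) (dlcoord x j).

(** The only point k of B_N at which f_(k+h+N e_d, S) may be non-zero at x. *)
Definition kpos a N x : 'rV[int]_d :=
  \row_j (height (dlcoord x j) - height (a j) - (lastc j)%:R *+ N).

Lemma depth_kpos a N x j : depth N (kpos a N x) j = height (dlcoord x j) - height (a j).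
Proof. by rewrite /depth mxE subrK. Qed.

Lemma fprodkE a phi k x : fprodk a (fun j s => (phi j s)%:C) k x =
  if [forall j, height (dlcoord x j) == k 0 j] then (treeprod a phi x)%:C else 0.
Proof.
rewrite /fprodk; under eq_bigr do rewrite ftreeE //.
case: ifPn => [/forallP e|/forallPn[j ne]].
  rewrite /treeprod rmorph_prod; apply: eq_bigr => j _.
  by have := e j; case: eqP.
by rewrite (bigD1 j) //= (negbTE ne) mul0r.
Qed.

Lemma gfun_kpos a N u phi x : gfun a N u (fun j s => (phi j s)%:C) x =
  if inBo N (kpos a N x) then u (kpos a N x) * (treeprod a phi x)%:C else 0.
Proof.
have kE k : [forall j, height (dlcoord x j) == (k + hvec a + evec_last d *+ N) 0 j] = (k == kpos a N x).
  apply/forallP/eqP => [e|-> j]; last by rewrite !mxE mulmxnE !mxE; lia.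
  by apply/rowP => j; have := e j; rewrite !mxE mulmxnE !mxE; lia.
rewrite /gfun (@fsbig_single _ _ _ (kpos a N x)) => [|k /eqP/negbTE ne].
  by rewrite fprodkE kE eqxx; case: ifPn => [/set_mem /= ->|/negP nk]; rewrite ?ifN //;
    apply/negP => ko; apply: nk; apply/mem_set.
by rewrite fprodkE kE ne mulr0.
Qed.

Lemma gfunE a N u phi x : V0 N u ->
  gfun a N u (fun j s => (phi j s)%:C) x = u (kpos a N x) * (treeprod a phi x)%:C.
Proof.
by move=> uV; rewrite gfun_kpos; case: ifPn => // /(V0_Bo uV) ->; rewrite mul0r.
Qed.

Section Polyhedron.
Variables (a : forall j, T j) (N : nat).
Hypothesis aN : N%:Z = polyheight a.

Lemma inA_kpos x : inA (kpos a N x).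
Proof.
rewrite /inA; under eq_bigr do rewrite mxE.
rewrite 2!sumrB dl_height sumrMnl sum_lastc //.
have -> : 1%Z *+ N = N%:Z by exact: natz.
by rewrite sub0r -/(polyheight a) -aN subrr.
Qed.

Lemma inBo_kpos x : inBo N (kpos a N x) <-> forall j, height (a j) < height (dlcoord x j).
Proof.
split=> [/inBoP[_ H] j|H]; first by have := H j; rewrite depth_kpos subr_gt0.
by apply/inBoP; split=> [|j]; [exact: inA_kpos | rewrite depth_kpos subr_gt0].
Qed.

Definition slice k : seq (DL T) := dl_prod (fun j => desc (a j) (absz (depth N k j))).

Definition polyhedron_points : seq (DL T) := flatten [seq slice k | k <- Bo_seq d N].

Lemma slice_kpos k x : inBo N k -> x \in slice k -> kpos a N x = k.
Proof.
move=> /inBoP[_ kj] /mem_dl_prod xk; apply/rowP => j; rewrite mxE.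
rewrite (height_desc (xk j)) gez0_abs ?ltW //; rewrite /depth; lia.
Qed.

Lemma polyhedron_points_uniq : uniq polyhedron_points.
Proof.
apply: (uniq_flatten_map (h := kpos a N)) (Bo_seq_uniq _ _) _ _.
  by move=> k _; apply: dl_prod_uniq => j; exact: desc_uniq.
by move=> k x; rewrite mem_Bo_seq //; exact: slice_kpos.
Qed.

Lemma gfun_supp u phi x : V0 N u -> x \notin polyhedron_points ->
  gfun a N u (fun j s => (phi j s)%:C) x = 0.
Proof.
move=> uV; apply: contraNeq; rewrite gfunE // => g0.
have ko : inBo N (kpos a N x).
  by apply: contraNT g0 => /(V0_Bo uV) ->; rewrite mul0r.
apply/flattenP; exists (slice (kpos a N x)); first by rewrite map_f // mem_Bo_seq.
apply/mem_dl_prod => j; rewrite mem_desc depth_kpos; apply/eqP.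
apply: (@treefun_depth R _ _ _ (phi j)); apply: contraNneq g0 => f0.
by rewrite /treeprod (bigD1 j) //= f0 mul0r mulr0.
Qed.

(** The support is cut into slices by the height vectors; on a slice u is constant
    and the products factorise over the trees. *)
Lemma inner_gfun a' N' u u' phi phi' : V0 N u -> V0 N' u' ->
  l2inner (gfun a N u (fun j s => (phi j s)%:C)) (gfun a' N' u' (fun j s => (phi' j s)%:C)) =
  \sum_(k <- Bo_seq d N)
    u k * (u' (k + (hvec a + evec_last d *+ N) - (hvec a' + evec_last d *+ N')))^* *
    (\prod_j \sum_(y <- desc (a j) (absz (depth N k j)))
       treefun (a j) (phi j) y * treefun (a' j) (phi' j) y)%:C.
Proof.
move=> uV uV'; rewrite (l2inner_finite polyhedron_points_uniq); last first.
  by move=> x /(gfun_supp phi uV) ->; rewrite mul0r.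
rewrite big_flatten /= big_map big_seq [RHS]big_seq; apply: eq_bigr => k.
rewrite mem_Bo_seq // => ko; have /inBoP[/eqP kA kj] := ko.
rewrite -(@sum_dl_prod _ _ T _ _ (fun j y => treefun (a j) (phi j) y * treefun (a' j) (phi' j) y)
  (fun j => height (a j) + depth N k j)).
- rewrite rmorph_sum mulr_sumr -/(slice k) big_seq [RHS]big_seq; apply: eq_bigr => x xk.
  rewrite !gfunE // (slice_kpos ko xk) conjM_real big_split rmorphM /=.
  have -> : kpos a' N' x = k + (hvec a + evec_last d *+ N) - (hvec a' + evec_last d *+ N').
    rewrite -(slice_kpos ko xk); apply/rowP => j; rewrite !mxE !mulmxnE !mxE; lia.
  by rewrite /treeprod; ring.
- rewrite big_split /= sum_depth //; last exact/eqP.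
  by rewrite aN /polyheight subrr.
- by move=> j y /height_desc ->; rewrite gez0_abs // ltW.
Qed.

End Polyhedron.


Section Eigenfunctions.
Variables (a : forall j, T j) (N : nat) (phi : forall j, 'I_(q j) -> R).
Arguments phi : clear implicits.
Hypothesis aN : N%:Z = polyheight a.
Hypothesis phi0 : forall j, \sum_l phi j l = 0.

Lemma kpos_move x i j (l : 'I_(q i)) : i != j ->
  kpos a N (dl_move x j l) = kpos a N x + evec i - evec j.
Proof.
move=> ij; apply/rowP => k; rewrite !mxE height_dl_move // !eqxx /=.
by ring.
Qed.

Let f j := treefun (a j) (phi j).
Let rest x i j := \prod_(k | (k != i) && (k != j)) f (dlcoord x k).

Lemma treeprod_move x i j (l : 'I_(q i)) : i != j ->
  treeprod a phi (dl_move x j l) =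
  f (child (dlcoord x i) l) * (f (par (dlcoord x j)) * rest x i j).
Proof.
move=> ij; rewrite /treeprod (bigD1 i) //= (bigD1 j) /= 1?eq_sym //.
rewrite (dl_move_up x l ij) (dl_move_down x l ij); congr (_ * (_ * _)).
by apply: eq_bigr => k /andP[ki kj]; rewrite dl_move_other.
Qed.

Lemma treeprod2 x i j : i != j ->
  treeprod a phi x = f (dlcoord x i) * (f (dlcoord x j) * rest x i j).
Proof. by move=> ij; rewrite /treeprod (bigD1 i) //= (bigD1 j) /= 1?eq_sym. Qed.

(** The simple random walk acts on the function attached to u as Q_N acts on
    u: a step goes up in one tree, where summation over the successors
    multiplies by sqrt q_i, and down in another one, where a factor sqrt q_j
    appears unless the lower face of the polyhedron is reached; there, u
    vanishes. *)
Lemma srw_gfun u z : V0 N u -> Qop q N u = (fun k => z * u k) ->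
  srw T R (gfun a N u (fun j s => (phi j s)%:C)) =
  fun x => z * gfun a N u (fun j s => (phi j s)%:C) x.
Proof.
move=> uV Qu; rewrite srw_nbop; apply/funext => x; rewrite /nbop sum_dl_nb.
have step i j : j != i ->
    \sum_l gfun a N u (fun j s => (phi j s)%:C) (dl_move (i := i) x j l) =
    u (kpos a N x + evec i - evec j) *
    (Num.sqrt (q i)%:R * f (dlcoord x i) * (f (par (dlcoord x j)) * rest x i j))%:C.
  rewrite eq_sym => ij; rewrite -sum_treefun_children // mulr_suml rmorph_sum mulr_sumr.
  by apply: eq_bigr => l _; rewrite gfunE // kpos_move // treeprod_move.
under eq_bigr do under eq_bigr do rewrite step //.
rewrite gfunE //; have [ko|nko] := boolP (inBo N (kpos a N x)).
  rewrite mulrA -[z * _](congr1 (@^~ (kpos a N x)) Qu) /= /Qop ko -mulrA; congr (_ * _).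
  rewrite mulr_suml; apply: eq_bigr => i _; rewrite mulr_suml; apply: eq_bigr => j ji.
  have [e|ne] := eqVneq (height (a j) + 1) (height (dlcoord x j)).
    rewrite (@V0_Bo _ _ N u) //; first by rewrite mulr0 !mul0r.
    apply/negP => /inBoP[_ /(_ j)]; rewrite /depth !mxE !eqxx /= -/(lastc j).
    by rewrite (negbTE ji) -e; lia.
  rewrite /f treefun_par // (@treeprod2 x i j) 1?eq_sym // natrM sqrtrM ?ler0n //.
  by rewrite /f !rmorphM /=; ring.
rewrite (V0_Bo uV nko) mul0r mulr0 big1 ?mulr0 // => i _; rewrite big1 // => j ji.
have /existsP[m] : [exists m, height (dlcoord x m) <= height (a m)].
  apply: contraNT nko; rewrite negb_exists => /forallP H; apply/inBo_kpos => // m.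
  by rewrite ltNge; apply: H.
move=> low; have fm : f (dlcoord x m) = 0 by apply: treefun_low.
have [e|mi] := eqVneq m i; first by rewrite -e fm mulr0 mul0r mulr0.
have [e|mj] := eqVneq m j.
  rewrite /f (@treefun_low _ _ _ (a j)) ?mul0r ?mulr0 // -e height_par.
  by apply: le_trans low; rewrite gerBl.
by rewrite /rest (bigD1 m) ?mi ?mj //= fm mul0r !mulr0.
Qed.

End Eigenfunctions.

(** In a coordinate where the apices differ, the factor is zero. *)
Lemma inner_gfun_neq a a' N N' u u' phi phi' :
  N%:Z = polyheight a -> V0 N u -> V0 N' u' ->
  (forall j, \sum_l phi j l = 0) -> (forall j, \sum_l phi' j l = 0) -> a <> a' ->
  l2inner (gfun a N u (fun j s => (phi j s)%:C)) (gfun a' N' u' (fun j s => (phi' j s)%:C)) = 0.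
Proof.
move=> aN uV uV' p0 p0' aa'; rewrite inner_gfun // big1 // => k _.
have [j jj] : exists j, a j <> a' j.
  by apply: contrapT => nj; apply: aa'; apply/functional_extensionality_dep => j;
     apply: contrapT => e; apply: nj; exists j.
by rewrite (bigD1 j) //= orthogonal_treefun // mul0r rmorph0 mulr0.
Qed.

Lemma inner_gfun_same a N u u' phi phi' :
  N%:Z = polyheight a -> V0 N u -> V0 N u' ->
  l2inner (gfun a N u (fun j s => (phi j s)%:C)) (gfun a N u' (fun j s => (phi' j s)%:C)) =
  V0inner N u u' * (\prod_j \sum_l phi j l * phi' j l)%:C.
Proof.
move=> aN uV uV'; rewrite inner_gfun // V0inner_Bo // mulr_suml big_seq [RHS]big_seq.
apply: eq_bigr => k; rewrite mem_Bo_seq // => /inBoP[_ kj]; rewrite addrK.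
congr (_ * _%:C); apply: eq_bigr => j _.
by have := kj j; case: (depth N k j) => [[//|n]|//] _; rewrite sum_treefun_sqr.
Qed.

End PolyhedronFunctions.

(** * Totality of the functions attached to polyhedra *)

Section Totality.
Variables (R : realType) (d : nat) (q : 'I_d -> nat) (T : forall j, tree (q j)).
Variables (psi : nat -> 'rV[int]_d -> 'rV[int]_d -> R[i]) (lam : nat -> 'rV[int]_d -> R[i]).
Local Notation C := R[i].
Hypothesis hd : (2 <= d)%N.
Hypothesis hq : forall j, (2 <= q j)%N.
Hypothesis hpsi : forall N, (2 <= N)%N -> Q_eigenbasis q N (psi N) (lam N).

Let d_gt0 : (0 < d)%N. Proof. exact: ltnW. Qed.
Let q_gt0 j : (0 < q j)%N. Proof. exact: ltnW. Qed.

Variable x0 : DL T.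

Local Notation level j := (height (dlcoord x0 j)).

Definition prodfun (h : forall j, T j -> R) (x : DL T) : C := (\prod_j h j (dlcoord x j))%:C.

Definition is_basic j (h : T j -> R) := exists a l,
  [/\ height a < level j, (1 <= l <= q j - 1)%N & h = horofun (level j) a (@phil R (q j) l)].

Definition is_point j (h : T j -> R) := h = fun y => (y == dlcoord x0 j)%:R.

(** Products of basis functions on the horocycles are the functions f_(k,S);
    these are combinations of the functions g_m, the psi_m being a basis. *)
Lemma is_basic_span (h : forall j, T j -> R) : (forall j, is_basic (h j)) ->
  cspan (basisB T psi) (prodfun h).
Proof.
move=> hb; pose a j := sval (cid (hb j)); pose l j := sval (cid (svalP (cid (hb j)))).
have Hal j : [/\ height (a j) < level j, (1 <= l j <= q j - 1)%N &
    h j = horofun (level j) (a j) (@phil R (q j) (l j))].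
  exact: (svalP (cid (svalP (cid (hb j))))).
pose phi j : 'I_(q j) -> R := @phil R (q j) (l j).
pose N := absz (polyheight a).
have eN : polyheight a = \sum_j (level j - height (a j)).
  by rewrite sumrB dl_height sub0r.
have leN : d%:Z <= polyheight a.
  have -> : d%:Z = \sum_(j < d) 1 by rewrite sumr_const card_ord natz.
  by rewrite eN; apply: ler_sum => j _; have [lt _ _] := Hal j; lia.
have aN : N%:Z = polyheight a by rewrite /N gez0_abs //; lia.
have N2 : (2 <= N)%N by lia.
have [psiV _ psiB _] := hpsi N2.
pose k := kpos a N x0.
have ko : inBo N k by apply/(inBo_kpos d_gt0 aN) => j; have [] := Hal j.
pose u k' : C := (k' == k)%:R.
have uV : V0 N u.
  have u0 k' : ~~ inBo N k' -> u k' = 0.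
    by rewrite /u; case: eqP => // ->; rewrite ko.
  split=> k'; first by move=> nB; apply: u0; apply: contra nB; apply: inBo_inB.
  by move=> /andP[_]; apply: u0.
have [c uc] := psiB u uV.
have -> : prodfun h = fun x => \sum_(m <- Bo_seq d N) c m * basis_fun a N (psi N m) l x.
  apply/funext => x; transitivity (gfun a N u (fun j s => (phi j s)%:C) x); last first.
    rewrite (gfunE d_gt0 q_gt0 a phi x uV) uc (_ : [set m | inBo N m] = [set` Bo_seq d N]).
      rewrite -fsbig_seq ?Bo_seq_uniq // mulr_suml big_seq [RHS]big_seq.
      apply: eq_bigr => m; rewrite mem_Bo_seq // => mo.
      by rewrite /basis_fun (gfunE d_gt0 q_gt0 a phi x (psiV m mo)) mulrA.
    by apply/seteqP; split=> m /=; rewrite mem_Bo_seq.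
  rewrite (gfunE d_gt0 q_gt0 a phi x uV) /u.
  have -> : (kpos a N x == k) = [forall j, height (dlcoord x j) == level j].
    apply/eqP/forallP => [e j|e]; last by apply/rowP => j; rewrite !mxE (eqP (e j)).
    have := congr1 (fun v : 'rV[int]_d => v 0 j) e; rewrite !mxE => ej.
    by apply/eqP; lia.
  rewrite /prodfun; case: (boolP [forall j, height (dlcoord x j) == level j]) => [/forallP e|/forallPn[j ne]].
    rewrite mul1r; congr (_%:C); apply: eq_bigr => j _; have [_ _ ->] := Hal j.
    by rewrite /horofun e.
  rewrite mul0r (bigD1 j) //=; have [_ _ ->] := Hal j.
  by rewrite /horofun (negbTE ne) mul0r.
apply: cspan_sum => m; rewrite mem_Bo_seq // => mo; apply/span_cspan/span_gen.
by exists a, N, m, l; split=> //; split=> // j; have [] := Hal j.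
Qed.

(** The factors occurring in the density argument have finite support in the
    horocycle of x0. *)
Definition horo_supp j (h : T j -> R) (L : seq (T j)) :=
  [/\ uniq L, forall y, y \in L -> height y = level j & forall y, y \notin L -> h y = 0].

Lemma is_basic_supp j (h : T j -> R) : is_basic h -> exists L, horo_supp h L.
Proof.
move=> [a [l [lt _ ->]]]; exists (desc a (absz (level j - height a)%R)); split.
- exact: desc_uniq.
- by move=> y /height_desc ->; lia.
move=> y; rewrite mem_desc /horofun => ya; case: (height y =P level j) => // hy.
by apply/eqP; apply: contraNT ya => /treefun_depth; rewrite hy => ->.
Qed.

Lemma is_point_supp j (h : T j -> R) : is_point h -> exists L, horo_supp h L.
Proof.
move=> ->; exists [:: dlcoord x0 j]; split=> // y; rewrite inE; first by move=> /eqP ->.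
by move=> /negbTE ->.
Qed.

Lemma horo_avg_horo_supp j M : horo_supp (@horo_avg R _ (T j) (dlcoord x0 j) M)
  (desc (iter M (@par _ (T j)) (dlcoord x0 j)) M).
Proof.
split; first exact: desc_uniq; last exact: horo_avg_supp.
by move=> y /height_desc ->; rewrite height_iter subrK.
Qed.

Lemma prodfun_nbound (h : forall j, T j -> R) (L : forall j, seq (T j)) :
  (forall j, horo_supp (h j) (L j)) ->
  nbound (prodfun h) (\prod_j \sum_(y <- L j) h j y ^+ 2).
Proof.
move=> hL; rewrite -(@sum_dl_prod _ _ _ _ _ (fun j y => h j y ^+ 2) (fun j => level j)).
- rewrite (eq_bigr (fun x => sqr_mod (prodfun h x))).
    apply: finite_nbound; first by apply: dl_prod_uniq => j; have [] := hL j.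
    move=> x xL; have [j jL] : exists j, dlcoord x j \notin L j.
      apply: contrapT => nj; case/negP: xL; apply/mem_dl_prod => j.
      by apply/negPn/negP => jL; apply: nj; exists j.
    have [_ _ h0] := hL j; rewrite /prodfun (bigD1 j) //= h0 // mul0r.
    by rewrite rmorph0.
  by move=> x _; rewrite sqr_modC -prodrXl.
- exact: dl_height.
- by move=> j; have [] := hL j.
Qed.

Lemma prodfun_dfwith (h : forall j, T j -> R) j0 g x :
  prodfun (dfwith h j0 g) x = (g (dlcoord x j0) * \prod_(j | j != j0) h j (dlcoord x j))%:C.
Proof.
rewrite /prodfun (bigD1 j0) //= dfwithin; congr ((_ * _)%:C).
by apply: eq_bigr => j ne; rewrite dfwithout // eq_sym.
Qed.

(** Basis functions are replaced by point masses one coordinate at a time, starting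
    from the last one: a point mass in one factor is a limit of combinations of
    basis functions, the other factors being fixed. *)
Lemma point_factors_span m : (m <= d)%N -> forall h : forall j, T j -> R,
  (forall j : 'I_d, (j < d - m)%N -> is_basic (h j)) ->
  (forall j : 'I_d, (d - m <= j)%N -> is_point (h j)) ->
  cspan (basisB T psi) (prodfun h).
Proof.
elim: m => [|m IH] md h hb hp.
  by apply: is_basic_span => j; apply: hb; rewrite subn0.
have jd : (d - m.+1 < d)%N by lia.
pose j0 : 'I_d := Ordinal jd.
have dfj (g : T j0 -> R) j : j != j0 -> dfwith h j0 g j = h j.
  by move=> ne; rewrite dfwithout // eq_sym.
pose W g := cspan (basisB T psi) (prodfun (dfwith h j0 g)).
have W0 : W (fun=> 0).
  rewrite /W (_ : prodfun _ = fun=> 0); first exact: cspan0.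
  by apply/funext => x; rewrite prodfun_dfwith mul0r rmorph0.
have Wlin c f g : W f -> W g -> W (fun y => c * f y + g y).
  move=> Wf Wg; have := cspan_lin c%:C Wf Wg; congr cspan; apply/funext => x.
  by rewrite !prodfun_dfwith mulrDl rmorphD -rmorphM mulrA.
have Wb a l : height a < level j0 -> (1 <= l <= q j0 - 1)%N ->
    W (horofun (level j0) a (@phil R (q j0) l)).
  move=> ha hl; apply: IH; first exact: ltnW.
    move=> j jm; have [e|ne] := eqVneq j j0; last first.
      rewrite dfj //; apply: hb.
      by move: ne jm; rewrite -val_eqE /= => /eqP; lia.
    by rewrite e dfwithin; exists a, l.
  move=> j jm; have ne : j != j0 by rewrite -val_eqE /=; apply/eqP; lia.
  by rewrite dfj //; apply: hp; lia.
have Wd := point_decomposition (q_gt0 j0) W0 Wlin Wb.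
have hj0 : h j0 = fun y => (y == dlcoord x0 j0)%:R by apply: hp => /=.
have sup j : exists L, horo_supp (h j) L.
  by have [/hb/is_basic_supp|/hp/is_point_supp] := ltnP j (d - m.+1).
pose L j := sval (cid (sup j)).
have hL j : horo_supp (h j) (L j) by exact: (svalP (cid (sup j))).
pose K := \prod_(j | j != j0) \sum_(y <- L j) h j y ^+ 2.
have K0 : 0 <= K by apply: prodr_ge0 => j _; apply: sumr_ge0 => y _; exact: sqr_ge0.
apply: cspan_lim => e e0.
have [M lt] := exp2_small (divr_gt0 e0 (ltr_wpDl K0 ltr01)).
exists (prodfun (dfwith h j0 (fun y => (y == dlcoord x0 j0)%:R - @horo_avg R _ (T j0) (dlcoord x0 j0) M y))).
  exact: Wd.
pose avg := @horo_avg R _ (T j0) (dlcoord x0 j0) M.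
pose DM := desc (iter M (@par _ (T j0)) (dlcoord x0 j0)) M.
have hs j : horo_supp (dfwith h j0 avg j) (dfwith L j0 DM j).
  have [->|ne] := eqVneq j j0; first by rewrite !dfwithin; exact: horo_avg_horo_supp.
  by rewrite dfj // (@dfwithout _ _ L) 1?eq_sym.
have := prodfun_nbound hs; rewrite (bigD1 j0) //= !dfwithin sum_horo_avg_sqr //.
rewrite (eq_bigr (fun j => \sum_(y <- L j) h j y ^+ 2)); last first.
  by move=> j ne; rewrite dfj // (@dfwithout _ _ L) 1?eq_sym.
rewrite -/K => /(nbound_ext (g := fun x => prodfun h x - prodfun (dfwith h j0
   (fun y => (y == dlcoord x0 j0)%:R - avg y)) x)) nb.
apply: (nbound_le _ (nb _)).
  have qM : (q j0)%:R ^- M <= 2 ^- M :> R.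
    rewrite lef_pV2 ?posrE ?exprn_gt0 ?ltr0n //.
    by apply: lerXn2r; rewrite ?nnegrE ?ler0n // ler_nat.
  apply: le_trans (ler_wpM2r K0 qM) _; move: lt; rewrite ltr_pdivlMr ?ltr_wpDl // => lt.
  by apply: le_trans (ltW lt); rewrite ler_pM2l ?exp2N_gt0 // lerDl.
move=> x; rewrite !prodfun_dfwith.
have -> : prodfun h x = ((dlcoord x j0 == dlcoord x0 j0)%:R * \prod_(j | j != j0) h j (dlcoord x j))%:C.
  by rewrite /prodfun (bigD1 j0) //= hj0.
by rewrite -rmorphB -mulrBl opprB addrC subrK.
Qed.

Lemma point_span : cspan (basisB T psi) (fun x => (x == x0)%:R).
Proof.
have := @point_factors_span d (leqnn d) (fun j y => (y == dlcoord x0 j)%:R).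
rewrite subnn => H; have {}H := H _ (fun j _ => erefl).
rewrite (_ : (fun x => _) = prodfun (fun j y => (y == dlcoord x0 j)%:R)); first exact: H.
apply/funext => x; rewrite /prodfun; have [->|ne] := eqVneq x x0.
  by rewrite big1 // => j _; rewrite eqxx.
have [j jj] : exists j, dlcoord x j != dlcoord x0 j.
  apply: contrapT => nj; case/eqP: ne; apply: dl_ext => j; apply/eqP.
  by apply/negPn/negP => jj; apply: nj; exists j.
by rewrite (bigD1 j) //= (negbTE jj) mul0r rmorph0.
Qed.

End Totality.

(** * The orthonormal basis and the spectrum *)

Section Orthonormality.
Variables (R : realType) (d : nat) (q : 'I_d -> nat) (T : forall j, tree (q j)).
Variables (psi : nat -> 'rV[int]_d -> 'rV[int]_d -> R[i]) (lam : nat -> 'rV[int]_d -> R[i]).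
Hypothesis hd : (2 <= d)%N.
Hypothesis hq : forall j, (2 <= q j)%N.
Hypothesis hpsi : forall N, (2 <= N)%N -> Q_eigenbasis q N (psi N) (lam N).

Let d_gt0 : (0 < d)%N. Proof. exact: ltnW. Qed.
Let q_gt0 j : (0 < q j)%N. Proof. exact: ltnW. Qed.

Let phi (l : 'I_d -> nat) j : 'I_(q j) -> R := @phil R (q j) (l j).

Lemma basis_fun_support (a : forall j, T j) N m l : basis_index a N m l ->
  forall x, x \notin polyhedron_points a N -> basis_fun a N (psi N m) l x = 0.
Proof.
move=> [_ N2 mo _] x; have [psiV _ _ _] := hpsi N2.
exact: (gfun_supp d_gt0 q_gt0 (phi l) (psiV m mo)).
Qed.

Lemma basis_fun_inner (a a' : forall j, T j) N N' m m' l l' :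
  basis_index a N m l -> basis_index a' N' m' l' ->
  l2inner (basis_fun a N (psi N m) l) (basis_fun a' N' (psi N' m') l') =
  (`[< [/\ a = a', m = m' & l = l'] >])%:R.
Proof.
move=> [aN N2 mo lq] [aN' N2' mo' lq'].
have [psiV psiO _ _] := hpsi N2; have [psiV' _ _ _] := hpsi N2'.
have phi0 (k : 'I_d -> nat) : (forall j, (1 <= k j <= q j - 1)%N) -> forall j, \sum_s phi k (j := j) s = 0.
  by move=> kq j; apply: sum_phil.
have [aa'|aa'] := pselect (a = a'); last first.
  rewrite asboolF; last by move=> [].
  by apply: (inner_gfun_neq d_gt0 q_gt0 aN (psiV m mo) (psiV' m' mo')) aa' => //; exact: phi0.
have NN : N' = N by move: aN'; rewrite -aa' -aN => -[].
subst N'; subst a'; rewrite (inner_gfun_same d_gt0 q_gt0 (phi l) (phi l') aN (psiV m mo) (psiV' m' mo')).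
rewrite psiO //; under eq_bigr do rewrite sum_philM //.
have [<-|mm] := eqVneq m m'; last by rewrite mul0r asboolF // => -[_ e]; rewrite e eqxx in mm.
rewrite mul1r; have [ll|ll] := pselect (l = l').
  by rewrite asboolT // big1 // => j _; rewrite ll eqxx.
rewrite asboolF; last by move=> [].
have [j jj] : exists j, l j <> l' j.
  by apply: contrapT => nj; apply: ll; apply/funext => j; apply: contrapT => e; apply: nj; exists j.
by rewrite (bigD1 j) //= (introF eqP jj) mul0r.
Qed.

Lemma inner_asbool_inj (g g' : DL T -> R[i]) (P : Prop) :
  l2inner g g = 1 -> l2inner g g' = (`[< P >])%:R -> g = g' -> P.
Proof.
move=> g1 gg' e; rewrite -e g1 in gg'; apply: contrapT => nP.
by move: gg'; rewrite asboolF // => /eqP; rewrite oner_eq0.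
Qed.

Lemma basis_fun_inj (a a' : forall j, T j) N N' m m' l l' :
  basis_index a N m l -> basis_index a' N' m' l' ->
  basis_fun a N (psi N m) l = basis_fun a' N' (psi N' m') l' ->
  [/\ a = a', m = m' & l = l'].
Proof.
move=> i i'; apply: (inner_asbool_inj _ (basis_fun_inner i i')).
by apply: etrans (basis_fun_inner i i) _; rewrite asboolT.
Qed.

Lemma basisB_inner f g : basisB T psi f -> basisB T psi g -> l2inner f g = (`[< f = g >])%:R.
Proof.
move=> [a [N [m [l [i ->]]]]] [a' [N' [m' [l' [i' ->]]]]].
rewrite (basis_fun_inner i i'); congr (_%:R); congr nat_of_bool.
apply/asboolP/asboolP => [[ea em el]|e].
  have [aN _ _ _] := i; have [aN' _ _ _] := i'.
  have NN : N = N' by move: aN; rewrite ea -aN' => -[].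
  by rewrite ea em el NN.
exact: basis_fun_inj i i' e.
Qed.

Lemma basis_fun_srw (a : forall j, T j) N m l : basis_index a N m l ->
  srw T R (basis_fun a N (psi N m) l) = fun x => lam N m * basis_fun a N (psi N m) l x.
Proof.
move=> [aN N2 mo lq]; have [psiV _ _ psiQ] := hpsi N2.
apply: (srw_gfun d_gt0 q_gt0 (phi := phi l) aN _ (psiV m mo) (psiQ m mo)).
by move=> j; apply: sum_phil.
Qed.

(** The height of the first apex is arbitrary, as the second one compensates it;
    this provides infinitely many polyhedra of each height. *)
Lemma exists_apices (N : nat) (h : int) : exists a : forall j, T j,
  N%:Z = polyheight a /\ height (a (Ordinal d_gt0)) = h.
Proof.
pose i0 : 'I_d := Ordinal d_gt0; pose i1 : 'I_d := Ordinal hd.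
pose k (j : 'I_d) : int := if j == i0 then h else if j == i1 then - N%:Z - h else 0.
pose a j := sval (cid (height_surj (T j) (k j) (q_gt0 j))).
have ha j : height (a j) = k j by exact: (svalP (cid (height_surj (T j) (k j) (q_gt0 j)))).
exists a; split; last by rewrite ha /k eqxx.
have ne : i0 != i1 by [].
rewrite /polyheight (@sum_two_changes d i0 i1 _ (fun=> 0)) //.
  by rewrite big1 // !ha /k eqxx eq_sym (negbTE ne) eqxx; lia.
by move=> j j0 j1; rewrite ha /k (negbTE j0) (negbTE j1).
Qed.

Let S : set (DL T -> R[i]) := basisB T psi.

(** The eigenvalue as a function of the eigenfunction, read off from any of its
    parametrisations. *)
Definition eigenvalue_of (g : DL T -> R[i]) : R[i] := xget 0 [set z | exists a N m l,
  [/\ basis_index a N m l, g = basis_fun a N (psi N m) l & z = lam N m]].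

Lemma eigenvalue_ofP g : S g -> exists a N m l,
  [/\ basis_index a N m l, g = basis_fun a N (psi N m) l & eigenvalue_of g = lam N m].
Proof.
move=> [a [N [m [l [i e]]]]]; rewrite /eigenvalue_of.
by case: xgetP => [z _ //|nz]; case: (nz (lam N m)); exists a, N, m, l.
Qed.

Lemma basisB_finite_support g : S g -> exists2 s : seq (DL T), uniq s & forall x, x \notin s -> g x = 0.
Proof.
move=> [a [N [m [l [i ->]]]]]; exists (polyhedron_points a N).
  by have [aN _ _ _] := i; apply: polyhedron_points_uniq.
exact: basis_fun_support.
Qed.

Lemma basisB_eigenfunction g : S g -> nbop ((dl_deg q)%:R^-1) (@dl_nb _ _ T) g = fun x => eigenvalue_of g * g x.
Proof.
move=> Sg; have [a [N [m [l [i eg ->]]]]] := eigenvalue_ofP Sg.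
by rewrite -srw_nbop eg; exact: basis_fun_srw.
Qed.

Lemma basisB_dense f : l2 f -> cspan S f.
Proof. by apply: delta_cspan => x0; exact: (point_span hd hq hpsi). Qed.

Lemma deg_real : (((dl_deg q)%:R^-1 : R[i])^*)%R = (dl_deg q)%:R^-1.
Proof. by rewrite fmorphV rmorph_nat. Qed.

(** An eigenfunction u of Q_N is transported to a polyhedron of height N by the
    functions with l_j = 1. The transport is isometric, so the result is not zero. *)
Lemma specQ_point_spectrum N z : specQ q R N z -> point_spectrum (srw T R) z.
Proof.
move=> [u [uV u0 Qu]]; have [a [aN _]] := exists_apices N 0.
have lq j : (1 <= (fun=> 1%N) j <= q j - 1)%N by have := hq j; lia.
pose p := phi (fun=> 1%N).
have p0 j : \sum_l p j l = 0 by apply: sum_phil.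
exists (gfun a N u (fun j s => (p j s)%:C)); split.
- apply: (@finite_l2 _ _ _ (polyhedron_points a N)); first by apply: polyhedron_points_uniq.
  by move=> x; apply: (gfun_supp d_gt0 q_gt0 p uV).
- move=> g0; apply: u0.
  have := inner_gfun_same d_gt0 q_gt0 p p aN uV uV; rewrite g0.
  rewrite (@l2inner_finite _ _ _ _ [::]) // => [|x _]; last by rewrite mul0r.
  rewrite big_nil big1 => [|j _]; last exact: sum_phil_sqr.
  rewrite mulr1 V0inner_Bo // => /esym s0; apply/funext => k.
  have [ko|/(V0_Bo uV) //] := boolP (inBo N k); apply: sqr_mod_eq0.
  move: s0; under eq_bigr do rewrite -sqr_mod_conj.
  rewrite -rmorph_sum /= => s0; have /eqP := @complexI R (\sum_(i <- Bo_seq d N) sqr_mod (u i)) 0 s0.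
  rewrite psumr_eq0 => [/allP/(_ k)|i _]; last exact: sqr_mod_ge0.
  by rewrite mem_Bo_seq // => /(_ ko) /eqP.
- exact: (srw_gfun d_gt0 q_gt0 aN p0 uV Qu).
Qed.

Lemma basis_fun_eigenfunction (a : forall j, T j) N m l : basis_index a N m l ->
  eigenfunction (srw T R) (lam N m) (basis_fun a N (psi N m) l).
Proof.
move=> i; have Sg : S (basis_fun a N (psi N m) l) by exists a, N, m, l.
have [lg g0 _] := orthonormal_eigenfunction basisB_finite_support (@basisB_inner) basisB_eigenfunction Sg.
by split=> //; exact: basis_fun_srw.
Qed.

Lemma point_spectrumE : point_spectrum (srw T R) =
  [set z | exists N m, [/\ (2 <= N)%N, inBo N m & z = lam N m]].
Proof.
apply/seteqP; split=> z.
  rewrite srw_nbop => /(point_spectrum_family deg_real (@dl_nb_uniq _ _ T) (@dl_nb_sym _ _ T)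
    basisB_finite_support (@basisB_inner) basisB_eigenfunction basisB_dense)[g /eigenvalue_ofP[a [N [m [l [[_ N2 mo _] _ e]]]]] ->].
  by exists N, m; rewrite e.
move=> [N [m [N2 mo ->]]]; have [a [aN _]] := exists_apices N 0.
exists (basis_fun a N (psi N m) (fun=> 1%N)); apply: basis_fun_eigenfunction.
by split=> // j; have := hq j; lia.
Qed.

Lemma point_spectrum_specQ : point_spectrum (srw T R) =
  \bigcup_(N in [set N | (2 <= N)%N]) specQ q R N.
Proof.
apply/seteqP; split=> [z|z [N _]]; last exact: specQ_point_spectrum.
rewrite point_spectrumE => -[N [m [N2 mo ->]]]; exists N => //.
have [psiV psiO _ psiQ] := hpsi N2; exists (psi N m); split.
- exact: psiV.
- move=> e; have := psiO m m mo mo; rewrite eqxx e (V0inner_Bo d_gt0); last by rewrite -e; exact: psiV.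
  by rewrite big1 => [/esym/eqP|k _]; [rewrite oner_eq0 | rewrite mul0r].
- exact: psiQ.
Qed.

(** The polyhedra with first apex at height 0, 1, ..., n - 1 give n distinct
    elements of the orthonormal family with the same eigenvalue. *)
Lemma srw_infinite_multiplicity z : point_spectrum (srw T R) z ->
  infinite_multiplicity (srw T R) z.
Proof.
rewrite point_spectrumE => -[N [m [N2 mo ->]]]; rewrite srw_nbop.
apply: (orthonormal_infinite_multiplicity basisB_finite_support (@basisB_inner) basisB_eigenfunction) => n.
pose a (i : 'I_n) := sval (cid (exists_apices N i%:Z)).
have aP i : N%:Z = polyheight (a i) /\ height (a i (Ordinal d_gt0)) = i%:Z.
  exact: (svalP (cid (exists_apices N i%:Z))).
have ia i : basis_index (a i) N m (fun=> 1%N).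
  by have [aN _] := aP i; split=> // j; have := hq j; lia.
exists (fun i => basis_fun (a i) N (psi N m) (fun=> 1%N)).
  move=> i i' /(basis_fun_inj (ia i) (ia i'))[ea _ _].
  by apply/val_inj; have [_ h] := aP i; have [_ h'] := aP i'; rewrite ea h' in h; case: h.
move=> i; have Sg : S (basis_fun (a i) N (psi N m) (fun=> 1%N)).
  by exists (a i), N, m, (fun=> 1%N).
split=> //; have [_ g0 eg] := basis_fun_eigenfunction (ia i).
have [x gx] : exists x, basis_fun (a i) N (psi N m) (fun=> 1%N) x != 0.
  by apply: contrapT => nx; apply: g0; apply/funext => x; apply/eqP/negPn/negP => gx; apply: nx; exists x.
apply: (mulIf gx); rewrite -(congr1 (@^~ x) (basisB_eigenfunction Sg)) -srw_nbop eg //.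
Qed.

Lemma basisB_orthonormal : orthonormal_basis S.
Proof.
split; first by move=> g /basisB_finite_support[s us s0]; exact: finite_l2 s0.
  exact: basisB_inner.
exact/cspan_total/basisB_dense.
Qed.

End Orthonormality.

Theorem mainTheorem12 (R : realType) (d : nat) (q : 'I_d -> nat)
  (hd : (2 <= d)%N) (hq : forall j, (2 <= q j)%N)
  (T : forall j, tree (q j))
  (psi : nat -> 'rV[int]_d -> 'rV[int]_d -> R[i])
  (lam : nat -> 'rV[int]_d -> R[i])
  (hpsi : forall N, (2 <= N)%N -> Q_eigenbasis q N (psi N) (lam N)) :
  let P := srw T R in
  [/\ pure_point P,
      spectrum P = closure (point_spectrum P : set (R[i] : numFieldType)),
      point_spectrum P
        = [set z | exists N m, [/\ (2 <= N)%N, inBo N m & z = lam N m]]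
      /\ point_spectrum P = \bigcup_(N in [set N | (2 <= N)%N]) specQ q R N,
      forall z, point_spectrum P z -> infinite_multiplicity P z
    & orthonormal_basis (basisB T psi)
      /\ forall (a : forall j, T j) N m l, basis_index a N m l ->
           let g := basis_fun a N (psi N m) l in
           eigenfunction P (lam N m) g /\ finite_set [set x | g x != 0]].
Proof.
move=> P; have fin := basisB_finite_support hd hq hpsi (T := T).
have orth := basisB_inner hd hq hpsi (T := T).
have eig := basisB_eigenfunction hd hq hpsi (T := T); have tot := basisB_dense hd hq hpsi (T := T).
split.
- by rewrite /P srw_nbop; exact: eigenfunctions_total fin orth eig tot.
- rewrite /P srw_nbop.
  by apply: spectrum_closure fin orth eig tot; [exact: deg_real|exact: dl_nb_uniq|exact: dl_nb_sym].
- by split; [exact: (point_spectrumE T hd hq hpsi) | exact: (point_spectrum_specQ T hd hq hpsi)].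
- exact: (srw_infinite_multiplicity hd hq hpsi).
split; first exact: (basisB_orthonormal T hd hq hpsi).
move=> a N m l i g; split; first exact: (basis_fun_eigenfunction hd hq hpsi).
apply: (@sub_finite_set _ _ [set` polyhedron_points a N]); last exact: finite_seq.
move=> x /= gx; apply: contraNT gx => xa; apply/eqP.
exact: (basis_fun_support hd hq hpsi i).
Qed.
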